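(* Let $\rho\in(0,1)$ and let $(X_1,\ldots,X_n)$ be a multivariate normal random vector with zero means, variances equal to one, and all correlations between distinct coordinates equal to $\rho$. Let $f(n,\rho)=P(X_1>0,\ldots,X_n>0)$. (1) There exists a universal constant $c_1>0$ (independent of $n$ and $\rho$) such that if $\rho>1/2$ and $n\geq 2$, then $$\frac{c_1}{\sqrt{2+(1/\rho-1)\log(n)}}\;\leq\;\frac{f(n,\rho)}{n^{1-1/\rho}}$$ and $$\frac{f(n,\rho)}{n^{1-1/\rho}}\;\leq\;\frac{1}{2^{2-1/\rho}}\sqrt{\frac{1-\rho}{\rho}}\,\bigl\{1+B(2,1/\rho-1)\bigr\}.$$ (2) If $\rho<1/2$ and $n$ satisfies $n\geq(1/\rho-1)\log(n)/\log(2)$, then $$\frac{1}{2^{2-1/\rho}}\sqrt{\frac{1-\rho}{\rho}}\,\bigl\{\Gamma(1/\rho-1)-1\bigr\}\;\leq\;\frac{f(n,\rho)}{n^{1-1/\rho}}.$$ Moreover (still for $\rho<1/2$), there exists $n_0=n_0(\rho)$ such that if $n\geq n_0$ then $$\frac{f(n,\rho)}{n^{1-1/\rho}}\;\leq\;\sqrt{\frac{1-\rho}{\rho}}\,\Bigl[(1/\rho-1)\log(n)^2\Bigr]^{1/\rho-2}.$$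
   Context: $\log$ is the natural logarithm and $\log(n)^2=(\log n)^2$. For $x>0$, $\Gamma(x)=\int_0^\infty t^{x-1}e^{-t}\,dt$ is the gamma function, and for $a,b>0$, $B(a,b)=\int_0^1 t^{a-1}(1-t)^{b-1}\,dt$ is the beta function.
   Formalization: In part (2), the lower bound is stated only for n ≥ 2; at n = 1 the condition on n always holds and the claimed inequality fails for small ρ (e.g. ρ = 1/10, where f = 1/2 but the left side is 2^8·3·(Γ(9)−1)). *)

(* Defs.v *)
From mathcomp Require Export all_boot all_order all_algebra.
From mathcomp Require Export all_classical all_reals all_analysis.
Set Implicit Arguments.
Unset Strict Implicit.
Unset Printing Implicit Defensive.
Export Order.TTheory GRing.Theory Num.Theory numFieldNormedType.Exports.
Local Open Scope classical_set_scope.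
Local Open Scope ring_scope.

(* The endpoints, where `^ of 0 to a negative power is the junk value 0, are
   left out; they form a null set. *)
Definition Gamma (R : realType) (x : R) : R :=
  \int[@lebesgue_measure R]_(t in `]0, +oo[) (t `^ (x - 1) * expR (- t)).

Definition Beta (R : realType) (a b : R) : R :=
  \int[@lebesgue_measure R]_(t in `]0, 1[)
    (t `^ (a - 1) * (1 - t) `^ (b - 1)).

(* N(m, s^2), with s the standard deviation; s = 0 is the point mass at m,
   whereas normal_prob m 0 is by convention the uniform law on [0, 1]. *)
Definition normal_law (R : realType) (m s : R) (A : set R) : \bar R :=
  if s == 0 then \d_m A else normal_prob m s A.

(* Every linear combination of the coordinates is univariate normal, possibly
   degenerate. *)
Definition multivariate_normal (R : realType) (d : measure_display)
    (T : measurableType d) (P : probability T R) (n : nat)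
    (X : 'I_n -> {RV P >-> R}) : Prop :=
  forall a : 'I_n -> R, exists m s : R, 0 <= s /\
    forall A : set R, measurable A ->
      P ((fun w => \sum_(i < n) a i * X i w) @^-1` A) = normal_law m s A.

Definition correlation (R : realType) (d : measure_display)
    (T : measurableType d) (P : probability T R) (X Y : {RV P >-> R}) : R :=
  fine (covariance P X Y) /
    (Num.sqrt (fine (variance P X)) * Num.sqrt (fine (variance P Y))).

Definition equicorrelated_normal (R : realType) (d : measure_display)
    (T : measurableType d) (P : probability T R) (n : nat) (rho : R)
    (X : 'I_n -> {RV P >-> R}) : Prop :=
  [/\ multivariate_normal X,
      forall i, expectation P (X i) = 0%E,
      forall i, variance P (X i) = 1%E &
      forall i j, i != j -> correlation (X i) (X j) = rho].

Definition orthant_prob (R : realType) (d : measure_display)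
    (T : measurableType d) (P : probability T R) (n : nat)
    (X : 'I_n -> {RV P >-> R}) : R :=
  fine (P [set w | forall i, 0 < X i w]).

(* Main.v *)
Require Import Defs.
From HB Require Import structures.
From mathcomp Require Import measurable_realfun ring lra.
Set Implicit Arguments.
Unset Strict Implicit.
Unset Printing Implicit Defensive.
Local Open Scope classical_set_scope.
Local Open Scope ring_scope.

(* Write X_i = sqrt rho * Y + sqrt (1 - rho) * Z_i with Y and the Z_i standard
   normal and independent: conditioning on Y gives
     f(n, rho) = E[Phi(sqrt (rho / (1 - rho)) * Y)^n].
   No independent variables have to be constructed for this: the identity
     E[prod_i h(X_i)] = E[(E[h(sqrt rho * Y + sqrt (1 - rho) * Z) | Y])^n]
   holds for a trigonometric polynomial h, because the cosine transform of a
   linear combination of the X_i is known, and the indicator of ]0, +oo[ is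
   reached from trigonometric polynomials by two bounded limits.

   With b = 1/rho - 1, al = sqrt b and w(u) = exp(-u^2/2), rescaling gives
     f = al * int Phi(u)^n w(u)^(b-1) phi(u) du,
   and the substitution t = -c ln Phi(u) turns
     int Phi(u)^(c-1) (-ln Phi(u))^(b-1) phi(u) du
   into c^(-b) Gamma(b). The inequalities
     4 Phi^2 (-ln Phi) <= 4 Phi (1 - Phi) <= w
   compare f with Gamma(b) for c = n + 2b - 1, from below if b >= 1 and from
   above if b <= 1. For the two remaining bounds, cut at u = sqrt (2 ln n),
   where w = 1/n, and use a lower bound of Mills' ratio. *)

(** * Gaussian integrals *)

(** The hypothesis makes each linear combination normal with unknown parameters, so there is no
    joint density to condition on. Cosines suit this: a product of trigonometric polynomials in the
    X_i expands into cosines of linear combinations. The indicator of ]0, +oo[ is reached through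
    the sign of a sine of growing period, itself a limit of polynomials in that sine.

    The 4 gives equality at u = 0, where Phi = 1/2 and w = 1. The left end of the chain depends on
    Phi alone, so the substitution in t integrates its powers; the factor Phi^2 only changes the
    power of Phi, whence c = n + 2b - 1. Raising to the power b - 1 keeps the inequality for b >= 1
    and reverses it for b <= 1, so each range of b gets one bound this way. In the other direction
    no constant serves, since w / (-ln Phi) grows like u as u tends to +oo. Cutting at sqrt (2 ln n)
    limits the loss to a factor of order sqrt (ln n), the source of the logarithms in the two
    remaining bounds. *)

Section density.
Local Open Scope ereal_scope.
Context d (T : measurableType d) (R : realType).
Variables (mu nu : {measure set T -> \bar R}) (g : T -> R).
Hypothesis mg : measurable_fun setT g.
Hypothesis g0 : forall x, (0 <= g x)%R.
Hypothesis nug : forall A, measurable A -> nu A = \int[mu]_(x in A) (g x)%:E.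

Import HBNNSimple.

Let integral_density_nnsfun (f : {nnsfun T >-> R}) :
  \int[nu]_x (f x)%:E = \int[mu]_x (f x * g x)%:E.
Proof.
under [LHS]eq_integral do rewrite fimfunE -fsumEFin//.
rewrite [LHS]ge0_integral_fsum//; last 2 first.
  - by move=> r; exact/measurable_EFinP/measurableT_comp.
  - by move=> n x _; rewrite EFinM nnfun_muleindic_ge0.
transitivity (\int[mu]_x (\sum_(y \in range f)
    (y * \1_(f @^-1` [set y]) x)%:E * (g x)%:E)).
  rewrite [RHS]ge0_integral_fsum//; last 2 first.
    - move=> r; apply: emeasurable_funM; last exact/measurable_EFinP.
      by apply/measurable_EFinP/measurableT_comp.
    - move=> n x _; apply: mule_ge0; last by rewrite lee_fin.
      by rewrite EFinM nnfun_muleindic_ge0.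
  apply: eq_fsbigr => r rf.
  have r0 : (0 <= r)%R by move: rf; rewrite inE => -[t _ <-].
  rewrite integralZl_indic_nnsfun// integral_indic// setIT nug//.
  under [RHS]eq_integral do rewrite EFinM -muleA.
  rewrite ge0_integralZl//; last 2 first.
    - by apply: emeasurable_funM; apply/measurable_EFinP => //; exact: measurable_indic.
    - by move=> x _; rewrite mule_ge0// lee_fin.
  congr (_ * _); rewrite integral_mkcond; apply: eq_integral => x _.
  by rewrite patchE indicE; case: ifPn => _; rewrite ?mul1e// mul0e.
apply: eq_integral => x _; rewrite -ge0_mule_fsuml; last first.
  by move=> r; rewrite EFinM nnfun_muleindic_ge0.
by rewrite EFinM; congr (_ * _); rewrite [in RHS]fimfunE -fsumEFin.
Qed.

(** Simple functions, then monotone convergence. This turns integrals against [normal_prob], known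
    by its values on sets, into Lebesgue integrals. *)
Lemma ge0_integral_density (f : T -> R) :
  measurable_fun setT f -> (forall x, (0 <= f x)%R) ->
  \int[nu]_x (f x)%:E = \int[mu]_x (f x * g x)%:E.
Proof.
move=> mf f0.
have mf' : measurable_fun setT (EFin \o f) by exact/measurable_EFinP.
pose f_ := nnsfun_approx measurableT mf'.
have f_f x : (f_ n x)%:E @[n --> \oo] --> (f x)%:E.
  by apply: (@cvg_nnsfun_approx _ _ _ _ measurableT _ mf') => // y _; rewrite lee_fin.
transitivity (limn (fun n => \int[nu]_x (f_ n x)%:E)).
  rewrite -monotone_convergence//=.
  - by apply: eq_integral => x _; apply/esym/cvg_lim.
  - by move=> n; exact/measurable_EFinP/measurable_funTS.
  - by move=> n x _; rewrite lee_fin.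
  - by move=> x _ a b ab; rewrite lee_fin; exact/lefP/nd_nnsfun_approx.
transitivity (limn (fun n => \int[mu]_x (f_ n x * g x)%:E)).
  by congr (limn _); apply/funext => n; rewrite integral_density_nnsfun.
rewrite -monotone_convergence//=.
- apply: eq_integral => x _; apply/cvg_lim => //.
  rewrite EFinM; under eq_fun do rewrite EFinM.
  by apply: cvgeZr => //; exact: f_f.
- by move=> n; apply/measurable_EFinP/measurable_funM.
- by move=> n x _; rewrite lee_fin mulr_ge0.
- move=> x _ a b ab; rewrite lee_fin ler_wpM2r//.
  exact/lefP/nd_nnsfun_approx.
Qed.

End density.

(** The density [normal_pdf 0 1] without its case distinction on the standard deviation, in a form
    that differentiates directly. *)
Definition std_pdf (R : realType) (x : R) : R :=
  (Num.sqrt (2 * pi))^-1 * expR (- (x ^+ 2 / 2)).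

Section std_pdf_theory.
Context (R : realType).
Implicit Types (x : R).
Local Notation mu := (@lebesgue_measure R).
Local Notation phi := (@std_pdf R).

Lemma std_pdfE : normal_pdf 0 1 = phi.
Proof.
apply/funext => x; rewrite normal_pdfE ?oner_neq0// /normal_peak /normal_fun /phi.
rewrite subr0 !expr1n; congr (_^-1 * expR _); last by lra.
by congr Num.sqrt; lra.
Qed.

Lemma std_pdf_gt0 x : 0 < phi x.
Proof.
by rewrite mulr_gt0 ?expR_gt0// invr_gt0 sqrtr_gt0 mulr_gt0 ?pi_gt0.
Qed.

Lemma std_pdf_ge0 x : 0 <= phi x. Proof. exact/ltW/std_pdf_gt0. Qed.

Lemma std_pdfN x : phi (- x) = phi x.
Proof. by rewrite /phi sqrrN. Qed.

Lemma is_derive_std_pdf x : is_derive x 1 phi (- x * phi x).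
Proof.
rewrite /phi; apply: is_derive_eq.
rewrite /GRing.scale/=; set a := _^-1; set b := expR _; lra.
Qed.

Lemma continuous_std_pdf : continuous phi.
Proof.
move=> x; apply/differentiable_continuous/derivable1_diffP.
by have [] := is_derive_std_pdf x.
Qed.

Lemma measurable_std_pdf : measurable_fun setT phi.
Proof. by apply: continuous_measurable_fun; exact: continuous_std_pdf. Qed.

Lemma integrable_std_pdf : mu.-integrable setT (EFin \o phi).
Proof. by rewrite -std_pdfE; exact: integrable_normal_pdf. Qed.

Lemma integral_std_pdf : (\int[mu]_x (phi x)%:E = 1)%E.
Proof. by rewrite -std_pdfE integral_normal_pdf. Qed.

(** Integration by parts on the whole line: the fundamental theorem on [-n, n], then dominated
    convergence with |h| as the bound. The Gaussian integrals below are found by exhibiting a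
    primitive that vanishes at infinity. *)
Lemma Rintegral_derive_eq0 (g h : R -> R) :
  (forall x : R, is_derive x 1 g (h x)) -> continuous h ->
  g n%:R @[n --> \oo] --> 0 -> g (- n%:R) @[n --> \oo] --> 0 ->
  mu.-integrable setT (EFin \o h) -> \int[mu]_x h x = 0.
Proof.
move=> gh ch gy gNy ih.
have mh : measurable_fun setT h by exact: continuous_measurable_fun.
pose A (n : nat) : set R := `[- n%:R, n%:R]%classic.
have cg : continuous g.
  move=> x; apply/differentiable_continuous/derivable1_diffP.
  by have [] := gh x.
have [||||_ _] := @dominated_convergence _ _ _ mu setT measurableT
  (fun n => EFin \o (h \_ (A n))) (EFin \o h) (EFin \o (Num.norm \o h))
  _ _ _ (integrable_norm ih) _.
- move=> n; have mA : measurable (A n) by exact: measurable_itv.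
  apply/measurable_EFinP; apply: (measurable_restrictT h mA).1.
  exact: measurable_funTS.
- exact/measurable_EFinP.
- apply: aeW => x _ /=; apply: cvg_near_cst; near=> n.
  rewrite patchE ifT// inE /A/= in_itv/= -ler_norml.
  by near: n; exact: nbhs_infty_ger.
- apply: aeW => x n _ /=; rewrite lee_fin patchE; case: ifPn => //.
  by rewrite normr0.
set u := (X in X @ _ --> _) => ucv.
(* For n = 0 the interval is a single point, so the fundamental theorem is applied from n + 1 on. *)
have uE n : u n.+1 = (g n.+1%:R - g (- n.+1%:R))%:E.
  rewrite /u/= EFinB -(@continuous_FTC2 R h g)//.
  - by rewrite [RHS]integral_mkcond; apply: eq_integral => x _; rewrite restrict_EFin.
  - by rewrite -subr_gt0 opprK -natrD ltr0n.
  - exact: continuous_subspaceT.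
  - split; first by move=> x _; have [] := gh x.
      by apply: cvg_at_right_filter; exact: cg.
    by apply: cvg_at_left_filter; exact: cg.
  - by move=> x _; rewrite derive1E; have [_] := gh x.
have u0 : u n @[n --> \oo] --> 0%:E.
  rewrite -cvg_shiftS; under eq_fun do rewrite uE.
  apply: cvg_EFin; first by near=> n.
  rewrite (_ : _ \o _ = (fun n => g n.+1%:R - g (- n.+1%:R)))//.
  rewrite -[0]subr0; apply: cvgB.
    by have := gy; rewrite -cvg_shiftS.
  by have := gNy; rewrite -(@cvg_shiftS _ (fun n => g (- n%:R))).
by rewrite /Rintegral; have /= -> := cvg_unique _ ucv u0.
Unshelve. all: end_near. Qed.

End std_pdf_theory.

(** * Second moments and cosine transform of the standard normal law *)

Section moments.
Context (R : realType).
Local Notation mu := (@lebesgue_measure R).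
Local Notation phi := (@std_pdf R).

(** Up to normalisation this is the density of N(0, 2); it is the common dominating function. *)
Lemma integrable_expRsqr4 :
  mu.-integrable setT (fun x : R => (expR (- (x ^+ 2 / 4)))%:E).
Proof.
have s0 : Num.sqrt 2 != 0 :> R by rewrite sqrtr_eq0 -ltNge.
have := integrableZl measurableT (normal_peak (Num.sqrt 2 : R))^-1
  (integrable_normal_pdf 0 (Num.sqrt 2 : R)).
apply: eq_integrable => // x _ /=.
rewrite normal_pdfE// -EFinM mulKf ?gt_eqF ?normal_peak_gt0//.
by rewrite /normal_fun subr0 sqr_sqrtr//; congr (expR _)%:E; lra.
Qed.

(** The Gaussian splits into two factors exp(-x^2/4): one absorbs the growth of [h], the other is
    integrable. *)
Lemma integrable_std_pdfM (h : R -> R) (c : R) :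
  measurable_fun setT h -> (forall x, `|h x| <= c * expR (x ^+ 2 / 4)) ->
  mu.-integrable setT (fun x => (h x * phi x)%:E).
Proof.
move=> mh hc.
have := integrableZl measurableT (c * (Num.sqrt (2 * pi))^-1) integrable_expRsqr4.
apply: le_integrable => //.
  by apply/measurable_EFinP; apply: measurable_funM => //; exact: measurable_std_pdf.
move=> x _ /=; rewrite lee_fin /std_pdf.
set k := (Num.sqrt (2 * pi))^-1.
have k0 : 0 <= k by rewrite invr_ge0 sqrtr_ge0.
rewrite !normrM !(ger0_norm (expR_ge0 _)) !(ger0_norm k0).
have -> : - (x ^+ 2 / 2) = - (x ^+ 2 / 4) - x ^+ 2 / 4 by lra.
rewrite expRD !mulrA ler_pM2r ?expR_gt0// mulrAC ler_wpM2r//.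
rewrite expRN ler_pdivrMr ?expR_gt0//.
apply: (le_trans (hc x)); rewrite ler_wpM2r ?expR_ge0//.
by rewrite ler_norm.
Qed.

Lemma ler_norm_expRsqr4 (x : R) : `|x| <= expR (x ^+ 2 / 4).
Proof.
apply: le_trans (expR_ge1Dx _).
have : 0 <= (`|x| / 2 - 1) ^+ 2 by exact: sqr_ge0.
have : `|x| ^+ 2 = x ^+ 2 by rewrite real_normK ?num_real.
lra.
Qed.

Lemma ler_sqr_expRsqr4 (x : R) : x ^+ 2 <= 4 * expR (x ^+ 2 / 4).
Proof. by have := expR_ge1Dx (x ^+ 2 / 4); lra. Qed.

Lemma ge1_expRsqr4 (x : R) : 1 <= expR (x ^+ 2 / 4).
Proof. by rewrite -[leLHS]expR0 ler_expR; have := sqr_ge0 x; lra. Qed.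

Lemma cvg_mul_std_pdf (h : R -> R) (c : R) (u : nat -> R) :
  (forall x, `|h x| <= c * (1 + `|x|)) -> (forall n, `|u n| = n%:R) ->
  h (u n) * phi (u n) @[n --> \oo] --> 0.
Proof.
move=> hc un.
have k0 : 0 <= (Num.sqrt (2 * pi : R))^-1 by rewrite invr_ge0 sqrtr_ge0.
have c0 : 0 <= c by have := le_trans (normr_ge0 _) (hc 0); rewrite normr0 addr0 mulr1.
(* The 16 is 2 * 8, from 1 + n <= 2n and exp(-n^2/2) <= 8 / n^2. *)
set K := c * (Num.sqrt (2 * pi))^-1 * 16.
have cK : K / n%:R @[n --> \oo] --> 0.
  rewrite -(mulr0 K); apply: cvgM; first exact: cvg_cst.
  rewrite gtr0_cvgV0; first exact: cvgr_idn.
  by near=> n; rewrite ltr0n; near: n; exists 1%N.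
apply: (@squeeze_cvgr _ _ _ _ (fun n => - (K / n%:R)) (fun n => K / n%:R)) => //; last first.
  by rewrite -oppr0; apply: cvgN.
near=> n; rewrite -ler_norml [X in X <= _]normrM.
have n0 : 0 < n%:R :> R by rewrite ltr0n; near: n; exists 1%N.
rewrite (@ger0_norm _ (phi (u n)) (std_pdf_ge0 _)) /std_pdf.
have -> : u n ^+ 2 = n%:R ^+ 2 by rewrite -un real_normK ?num_real.
have e : expR (- (n%:R ^+ 2 / 2)) <= 8 / n%:R ^+ 2 :> R.
  rewrite expRN -[leRHS]invf_div lef_pV2 ?posrE ?expR_gt0 ?divr_gt0 ?exprn_gt0//.
  have := expR_ge1Dx (n%:R ^+ 2 / 2 : R).
  have : 0 <= n%:R ^+ 2 :> R by exact: sqr_ge0.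
  lra.
apply: (@le_trans _ _ (c * (n%:R + n%:R) * ((Num.sqrt (2 * pi))^-1 * (8 / n%:R ^+ 2)))).
  apply: ler_pM => //; last by rewrite ler_wpM2l.
  by rewrite (le_trans (hc _))// un ler_wpM2l// lerD2r ler1n; near: n; exists 1%N.
by rewrite le_eqVlt; apply/orP; left; apply/eqP; rewrite /K; field;
  rewrite !gt_eqF// sqrtr_gt0 mulr_gt0// pi_gt0.
Unshelve. all: end_near. Qed.

(** After subtraction of m^2 + s^2 the integrand is the derivative of -(s^2 x + 2 m s) phi(x). *)
Lemma std_pdf_sqr_affine (m s : R) :
  \int[mu]_x ((m + s * x) ^+ 2 * phi x) = m ^+ 2 + s ^+ 2.
Proof.
pose h (x : R) := (m + s * x) ^+ 2 - (m ^+ 2 + s ^+ 2).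
have ch : continuous h.
  move=> x; apply/differentiable_continuous/derivable1_diffP.
  have : is_derive x (1 : R) h (s * (m + s * x) *+ 2).
    rewrite /h; apply: is_derive_eq; rewrite /GRing.scale/=; lra.
  by case.
have ih : mu.-integrable setT (fun x => (h x * phi x)%:E).
  apply: (@integrable_std_pdfM h (2 * `|m * s| + 4 * s ^+ 2 + s ^+ 2)).
    exact: continuous_measurable_fun.
  move=> x; rewrite /h.
  have -> : (m + s * x) ^+ 2 - (m ^+ 2 + s ^+ 2) =
    2 * ((m * s) * x) + s ^+ 2 * x ^+ 2 - s ^+ 2 by ring.
  set E := expR _.
  have A : `|m * s * x| <= `|m * s| * E.
    by rewrite normrM ler_wpM2l// ler_norm_expRsqr4.
  have B : s ^+ 2 * x ^+ 2 <= s ^+ 2 * (4 * E).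
    by rewrite ler_wpM2l ?sqr_ge0 ?ler_sqr_expRsqr4.
  have C : s ^+ 2 <= s ^+ 2 * E.
    by rewrite ler_peMr ?sqr_ge0 ?ge1_expRsqr4.
  have D : 0 <= s ^+ 2 * x ^+ 2 by rewrite mulr_ge0 ?sqr_ge0.
  move: A; rewrite !ler_norml => /andP[A1 A2].
  by apply/andP; split; have := sqr_ge0 s; lra.
have i0 : \int[mu]_x (h x * phi x) = 0.
  apply: (@Rintegral_derive_eq0 _ (fun x => - (s ^+ 2 * x + 2 * (m * s)) * phi x)) => //.
  - move=> x; have := is_derive_std_pdf x => ?.
    apply: is_derive_eq; rewrite /h /GRing.scale/=; ring.
  - by move=> x; apply: cvgM; [exact: ch|exact: continuous_std_pdf].
  - apply: (@cvg_mul_std_pdf (fun x => - (s ^+ 2 * x + 2 * (m * s))) (s ^+ 2 + 2 * `|m * s|)).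
      move=> x; rewrite normrN (le_trans (ler_normD _ _))//.
      rewrite normrM (ger0_norm (sqr_ge0 s)) [`|2 * _|]normrM (ger0_norm (ler0n _ 2)).
      have := normr_ge0 (m * s); have := normr_ge0 x; have := sqr_ge0 s; nra.
    by move=> n; rewrite normr_nat.
  - apply: (@cvg_mul_std_pdf (fun x => - (s ^+ 2 * x + 2 * (m * s))) (s ^+ 2 + 2 * `|m * s|)).
      move=> x; rewrite normrN (le_trans (ler_normD _ _))//.
      rewrite normrM (ger0_norm (sqr_ge0 s)) [`|2 * _|]normrM (ger0_norm (ler0n _ 2)).
      have := normr_ge0 (m * s); have := normr_ge0 x; have := sqr_ge0 s; nra.
    by move=> n; rewrite normrN normr_nat.
have i2 : mu.-integrable setT (EFin \o (fun x => (m ^+ 2 + s ^+ 2) * phi x)).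
  exact: (integrableZl measurableT (m ^+ 2 + s ^+ 2) (integrable_std_pdf R)).
have := RintegralD measurableT ih i2.
rewrite i0 add0r RintegralZl//; last exact: integrable_std_pdf.
rewrite [X in _ = _ * X]/Rintegral integral_std_pdf/= mulr1 => <-.
by apply: eq_Rintegral => x _; rewrite /h -mulrDl subrK.
Qed.

Lemma continuous_cos_affine (a b : R) : continuous (fun x : R => cos (a * x + b)).
Proof.
move=> x; apply/differentiable_continuous/derivable1_diffP.
by have : is_derive x (1 : R) (fun x => cos (a * x + b)) (- sin (a * x + b) * a);
 [apply: is_derive_eq; rewrite /GRing.scale/=; ring|case].
Qed.

Lemma integrable_cos_std_pdf (a b : R) :
  mu.-integrable setT (fun x => (cos (a * x + b) * phi x)%:E).
Proof.
apply: (@integrable_std_pdfM (fun x => cos (a * x + b)) 1) => [|x].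
  by apply: continuous_measurable_fun; exact: continuous_cos_affine.
by rewrite mul1r (le_trans _ (ge1_expRsqr4 x))// ler_norml cos_geN1 cos_le1.
Qed.

(** As a function of the frequency, the integral C solves C'(t) = -t C(t): differentiating under the
    integral sign brings down -x sin, and integration by parts turns it back into a cosine. *)
Lemma std_pdf_cos (t c : R) :
  \int[mu]_x (cos (t * x + c) * phi x) = cos c * expR (- (t ^+ 2 / 2)).
Proof.
have msin (a b : R) : continuous (fun x : R => sin (a * x + b)).
  move=> x; apply/differentiable_continuous/derivable1_diffP.
  by have : is_derive x (1 : R) (fun x => sin (a * x + b)) (cos (a * x + b) * a);
   [apply: is_derive_eq; rewrite /GRing.scale/=; ring|case].
have ixsin (a b : R) : mu.-integrable setT (fun x => (- x * sin (a * x + b) * phi x)%:E).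
  apply: (@integrable_std_pdfM (fun x => - x * sin (a * x + b)) 1) => //.
    apply: continuous_measurable_fun => x.
    by apply: cvgM; [apply: cvgN; exact: cvg_id|exact: msin].
  move=> x; rewrite mul1r normrM normrN (le_trans _ (ler_norm_expRsqr4 x))//.
  by rewrite ler_piMr// ler_norml sin_geN1 sin_le1.
pose C (t : R) := \int[mu]_x (cos (t * x + c) * phi x).
have parts (a : R) : \int[mu]_x (- x * sin (a * x + c) * phi x) = - a * C a.
  have : \int[mu]_x (a * (cos (a * x + c) * phi x) + (- x * sin (a * x + c) * phi x)) = 0.
    apply: (@Rintegral_derive_eq0 _ (fun x => sin (a * x + c) * phi x)) => //.
    - move=> x; have := is_derive_std_pdf x => ?.
      apply: is_derive_eq; rewrite /GRing.scale/=; ring.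
    - move=> x; apply: cvgD.
        apply: cvgM; first exact: cvg_cst.
        by apply: cvgM; [exact: continuous_cos_affine|exact: continuous_std_pdf].
      apply: cvgM; last exact: continuous_std_pdf.
      by apply: cvgM; [apply: cvgN; exact: cvg_id|exact: msin].
    - apply: (@cvg_mul_std_pdf (fun x => sin (a * x + c)) 1) => [x|n].
        by rewrite mul1r (@le_trans _ _ 1) ?ler_norml ?sin_geN1 ?sin_le1 ?lerDl.
      by rewrite normr_nat.
    - apply: (@cvg_mul_std_pdf (fun x => sin (a * x + c)) 1) => [x|n].
        by rewrite mul1r (@le_trans _ _ 1) ?ler_norml ?sin_geN1 ?sin_le1 ?lerDl.
      by rewrite normrN normr_nat.
    - exact: (integrableD measurableT (integrableZl measurableT a (integrable_cos_std_pdf a c)) (ixsin a c)).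
  have i1 : mu.-integrable setT (EFin \o (fun x => a * (cos (a * x + c) * phi x))).
    exact: (integrableZl measurableT a (integrable_cos_std_pdf a c)).
  rewrite (RintegralD measurableT i1 (ixsin a c)).
  rewrite (RintegralZl a measurableT (integrable_cos_std_pdf a c)) -/(C a) => /eqP.
  by rewrite addrC addr_eq0 -mulNr => /eqP.
have dC (a : R) : is_derive a (1 : R) C (- a * C a).
  have Ia : `]a - 1, a + 1[%classic a by rewrite /= in_itv/=; lra.
  pose f (b x : R) := cos (b * x + c) * phi x.
  have df (b x : R) : is_derive b (1 : R) (f ^~ x) (- x * sin (b * x + c) * phi x).
    rewrite /f; apply: is_derive_eq; rewrite /GRing.scale/=; ring.
  have d1f (b x : R) : partial1of2 f b x = - x * sin (b * x + c) * phi x.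
    by rewrite partial1of2E; have [_] := df b x.
  have h1 (x : R) : `]a - 1, a + 1[%classic x -> mu.-integrable setT (EFin \o f x).
    by move=> _; exact: integrable_cos_std_pdf.
  have h2 (x y : R) : `]a - 1, a + 1[%classic x -> setT y -> derivable (f ^~ y) x 1.
    by move=> _ _; have [] := df x y.
  have h3 (y : R) : 0 <= `|y| * phi y by rewrite mulr_ge0 ?std_pdf_ge0.
  have h4 : mu.-integrable setT (EFin \o (fun y => `|y| * phi y)).
    apply: (@integrable_std_pdfM (fun y => `|y|) 1) => // x.
    by rewrite normr_id mul1r ler_norm_expRsqr4.
  have h5 (x y : R) : `]a - 1, a + 1[%classic x -> setT y -> `|partial1of2 f x y| <= `|y| * phi y.
    move=> _ _; rewrite d1f normrM (@ger0_norm _ (phi y) (std_pdf_ge0 _)) normrM normrN.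
    by rewrite ler_wpM2r ?std_pdf_ge0// ler_piMr// ler_norml sin_geN1 sin_le1.
  split.
    exact: (derivable_under_integral measurableT Ia h1 h2 h3 h4 h5).
  rewrite -derive1E (differentiation_under_integral measurableT Ia h1 h2 h3 h4 h5).
  by rewrite -parts; apply: eq_Rintegral => x _; rewrite d1f.
(* C' (a) = - a * C a, so that F below is constant. *)
pose F (a : R) : R := C a * expR (a ^+ 2 / 2).
have F0 : F 0 = cos c.
  rewrite /F expr2 mul0r mul0r expR0 mulr1 /C.
  under eq_Rintegral do rewrite mul0r add0r.
  rewrite (RintegralZl _ measurableT (integrable_std_pdf R)).
  by rewrite [X in _ * X]/Rintegral integral_std_pdf/= mulr1.
have : F t = cos c.
  rewrite -F0; apply: (@is_derive_0_is_cst _ F) => x.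
  have := dC x => ?; apply: is_derive_eq; rewrite /GRing.scale/=; by field.
rewrite -/(C t) /F => <-.
by rewrite -mulrA -expRD subrr expR0 mulr1.
Qed.

End moments.

(** * Integrals of functions of a normal variable *)

Section normal_law_integral.
Context (R : realType).
Local Notation mu := (@lebesgue_measure R).
Local Notation phi := (@std_pdf R).

Lemma normal_pdf_std (m s x : R) : 0 < s ->
  normal_pdf m s x = s^-1 * phi ((x - m) / s).
Proof.
move=> s0; rewrite normal_pdfE ?gt_eqF// /normal_peak /normal_fun /std_pdf mulrA.
congr (_ * expR _); last by field; rewrite gt_eqF.
rewrite -invfM; congr (_^-1).
by rewrite -mulrnAr sqrtrM ?sqr_ge0// sqrtr_sqr gtr0_norm// mulr_natl.
Qed.

Lemma ge0_integral_affine (m s : R) (H : R -> R) : 0 < s ->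
  continuous H -> (forall x, 0 <= H x) ->
  (\int[mu]_x (H x)%:E = \int[mu]_x (H (m + s * x) * s)%:E)%E.
Proof.
move=> s0 cH H0.
pose F (z : R) := (z + m / s) * s.
have dF (z : R) : is_derive z (1 : R) F s.
  by rewrite /F; apply: is_derive_eq; rewrite /GRing.scale/=; ring.
have F'E : F^`()%classic = cst s.
  by apply/funext => z; rewrite derive1E; have [_] := dF z.
rewrite (@increasing_ge0_integration_by_substitutionT R F H)//.
- apply: eq_integral => x _ /=; rewrite F'E; congr (H _ * _)%:E.
  by rewrite /F mulrDl divfK ?gt_eqF// addrC mulrC.
- by move=> x y xy; rewrite /F ltr_pM2r// ltrD2r.
- by rewrite F'E => ?; exact: cvg_cst.
- by rewrite F'E; exact: is_cvg_cst.
- by rewrite F'E; exact: is_cvg_cst.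
- by apply/gt0_cvgMlNy; last exact: cvg_addrr_Ny.
- by apply/gt0_cvgMly; last exact: cvg_addrr.
Qed.

End normal_law_integral.

Section rv.
Context (R : realType) d (T : measurableType d) (P : probability T R).
Local Notation mu := (@lebesgue_measure R).

Lemma bounded_integrable (f : T -> R) (M : R) : measurable_fun setT f ->
  (forall w, `|f w| <= M) -> P.-integrable setT (EFin \o f).
Proof.
move=> mf fM; apply: measurable_bounded_integrable => //.
  by have /= -> := probability_setT P; rewrite ltry.
exists M; split; first exact: num_real.
by move=> k k1 w _ /=; rewrite (le_trans (fM w))// ltW.
Qed.

Lemma bounded_cvg_Rintegral (f_ : nat -> T -> R) (f : T -> R) (M : R) :
  (forall k, measurable_fun setT (f_ k)) -> (forall k w, `|f_ k w| <= M) ->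
  (forall w, f_ k w @[k --> \oo] --> f w) ->
  \int[P]_w f_ k w @[k --> \oo] --> \int[P]_w f w.
Proof.
move=> mf fM ff.
have mlim : measurable_fun setT f.
  by apply: (measurable_fun_cvg mf) => w _; exact: ff.
have bM : P.-integrable setT (EFin \o cst M) by exact: finite_measure_integrable_cst.
have [||||ilim _] := @dominated_convergence _ _ _ P setT measurableT
  (fun k => EFin \o f_ k) (EFin \o f) (EFin \o cst M) _ _ _ bM _.
- by move=> k; exact/measurable_EFinP.
- exact/measurable_EFinP.
- by apply: aeW => w _ /=; apply: cvg_EFin; [near=> k|exact: ff].
- by apply: aeW => w k _ /=; rewrite lee_fin.
by move=> h; apply: fine_cvg; rewrite fineK ?integrable_fin_num.
Unshelve. all: end_near. Qed.

Lemma probability_Rintegral_cst (c : R) : \int[P]_w (cst c) w = c.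
Proof. by rewrite Rintegral_cst//; have /= -> := probability_setT P; rewrite mulr1. Qed.

(** Nonnegative [G] and extended reals avoid any integrability condition. Writing the variable as m
    + s x treats the point mass s = 0 and the case with a density by one formula. *)
Lemma normal_law_integral (W : {mfun T >-> R}) (m s : R) (G : R -> R) : 0 <= s ->
  (forall A : set R, measurable A -> P (W @^-1` A) = normal_law m s A) ->
  continuous G -> (forall x, 0 <= G x) ->
  (\int[P]_w (G (W w))%:E = \int[mu]_x (G (m + s * x) * std_pdf x)%:E)%E.
Proof.
move=> s0 WA cG G0.
have mG : measurable_fun setT (EFin \o G).
  by apply/measurable_EFinP; exact: continuous_measurable_fun.
have mW : measurable_fun setT (W : T -> measurableTypeR R) by exact: (@measurable_funPT _ _ _ _ W).
pose V : {mfun T >-> measurableTypeR R} :=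
  HB.pack (W : T -> measurableTypeR R) (isMeasurableFun.Build _ _ _ _ _ mW).
have E1 : (\int[P]_w (G (W w))%:E = \int[pushforward P V]_x (G x)%:E)%E.
  by rewrite ge0_integral_pushforward// => x _; rewrite lee_fin.
rewrite {}E1; have [s00|sn0] := eqVneq s 0.
  rewrite [LHS](eq_measure_integral (\d_(m : measurableTypeR R))); last first.
    by move=> A mA _; move: (WA A mA); rewrite /normal_law s00 eqxx.
  rewrite integral_dirac// diracT mul1e.
  transitivity (\int[mu]_x ((G m)%:E * (std_pdf x)%:E))%E; last first.
    by apply: eq_integral => x _; rewrite s00 mul0r addr0 EFinM.
  rewrite ge0_integralZl ?lee_fin//; last 2 first.
  - by apply/measurable_EFinP; exact: measurable_std_pdf.
  - by move=> x _; rewrite lee_fin std_pdf_ge0.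
  by rewrite integral_std_pdf mule1.
rewrite [LHS](eq_measure_integral (normal_prob m s)); last first.
  by move=> A mA _; move: (WA A mA); rewrite /normal_law (negbTE sn0).
have {}s0 : 0 < s by rewrite lt_neqAle eq_sym sn0.
rewrite (@ge0_integral_density _ _ _ mu _ (normal_pdf m s))//; last 3 first.
- exact: measurable_normal_pdf.
- by move=> x; exact: normal_pdf_ge0.
- exact: continuous_measurable_fun.
rewrite (@ge0_integral_affine R m s)//; last 2 first.
- move=> x; apply: cvgM; first exact: cG.
  by apply: continuous_normal_pdf; rewrite gt_eqF.
- by move=> x; rewrite mulr_ge0 ?normal_pdf_ge0.
apply: eq_integral => x _; rewrite normal_pdf_std//; congr _%:E.
have -> : (m + s * x - m) / s = x by field; rewrite gt_eqF.
by field; rewrite gt_eqF.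
Qed.

End rv.

(** * The orthant probability as a one-dimensional integral *)

Section equicorrelated.
Context (R : realType) d (T : measurableType d) (P : probability T R) (n : nat)
  (rho : R) (X : 'I_n -> {RV P >-> R}).
Hypothesis hX : equicorrelated_normal rho X.
Local Notation mu := (@lebesgue_measure R).

Let cov i j : covariance P (X i) (X j) = (\int[P]_w (X i w * X j w)%:E)%E.
Proof.
have [_ E0 _ _] := hX.
rewrite unlock !E0 unlock; apply: eq_integral => w _ /=.
by rewrite !fctE/= !subr0.
Qed.

Let iX2 i : P.-integrable setT (fun w => (X i w * X i w)%:E).
Proof.
have [_ _ V1 _] := hX.
apply/integrableP; split; first exact/measurable_EFinP/measurable_funM.
under eq_integral do rewrite gee0_abs ?lee_fin -?expr2 ?sqr_ge0//.
by rewrite -cov; have := V1 i; rewrite /variance => ->; rewrite ltry.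
Qed.

Let iXX i j : P.-integrable setT (fun w => (X i w * X j w)%:E).
Proof.
apply: le_integrable (integrableD measurableT (iX2 i) (iX2 j)) => //.
  exact/measurable_EFinP/measurable_funM.
move=> w _ /=; rewrite lee_fin [leRHS]ger0_norm; last first.
  by rewrite addr_ge0// -expr2 sqr_ge0.
by rewrite ler_norml; apply/andP; split; nra.
Qed.

Let eXX i j : (\int[P]_w (X i w * X j w)%:E = (if i == j then 1 else rho)%:E)%E.
Proof.
have [_ _ V1 C] := hX.
have fin : (\int[P]_w (X i w * X j w)%:E \is a fin_num)%E by exact: integrable_fin_num.
have [->|ij] := eqVneq i j; first by rewrite -cov; exact: V1.
rewrite -(fineK fin); congr _%:E.
by have := C _ _ ij; rewrite /correlation !V1/= sqrtr1 mulr1 divr1 cov.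
Qed.

Let iX i : P.-integrable setT (fun w => (X i w)%:E).
Proof.
have i1 := finite_measure_integrable_cst P 1 measurableT.
apply: le_integrable (integrableD measurableT i1 (iX2 i)) => //.
  exact/measurable_EFinP.
move=> w _ /=; rewrite lee_fin [leRHS]ger0_norm; last first.
  by rewrite addr_ge0// -expr2 sqr_ge0.
by rewrite ler_norml; apply/andP; split; nra.
Qed.

Let eX i : (\int[P]_w (X i w)%:E = 0)%E.
Proof. by have [_ E0 _ _] := hX; have := E0 i; rewrite unlock. Qed.

(** The variance of the linear combination with coefficients [a]: the quadratic form of the
    covariance matrix (1 - rho) I + rho J, with J the all-ones matrix. *)
Definition equi_var (a : 'I_n -> R) : R :=
  (1 - rho) * \sum_i a i ^+ 2 + rho * (\sum_i a i) ^+ 2.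

(** The shift [c] makes one formula carry both mean and variance: its values at c = 0 and c = 1
    determine the parameters of the normal law. *)
Let second_moment (a : 'I_n -> R) (c : R) :
  (\int[P]_w ((\sum_i a i * X i w + c) ^+ 2)%:E = (equi_var a + c ^+ 2)%:E)%E.
Proof.
have E w : (((\sum_i a i * X i w + c) ^+ 2)%:E =
  \sum_i \sum_j (a i * a j)%:E * (X i w * X j w)%:E +
  (\sum_i (2 * c * a i)%:E * (X i w)%:E + (c ^+ 2)%:E))%E.
  under [in RHS]eq_bigr => i _ do under eq_bigr => j _ do rewrite -EFinM.
  under [in RHS]eq_bigr => i _ do rewrite sumEFin.
  under [X in (_ + (X + _))%E]eq_bigr => i _ do rewrite -EFinM.
  rewrite !sumEFin -!EFinD; congr _%:E.
  rewrite sqrrD -addrA; congr (_ + (_ + _)).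
    rewrite expr2 big_distrlr/=; apply: eq_bigr => i _; apply: eq_bigr => j _; ring.
  by rewrite mulr_suml -sumrMnl; apply: eq_bigr => i _; ring.
under eq_integral do rewrite E.
have i2 : P.-integrable setT (fun w => \sum_i \sum_j (a i * a j)%:E * (X i w * X j w)%:E)%E.
  apply: integrable_sum => // i _; apply: integrable_sum => // j _.
  exact: integrableZl.
have i1 : P.-integrable setT (fun w => \sum_i (2 * c * a i)%:E * (X i w)%:E)%E.
  by apply: integrable_sum => // i _; exact: integrableZl.
have i0 := finite_measure_integrable_cst P (c ^+ 2) measurableT.
rewrite integralD//; last exact: integrableD.
rewrite integralD// integral_sum//; last first.
  by move=> i; apply: integrable_sum => // j _; exact: integrableZl.
rewrite integral_sum//; last by move=> i; exact: integrableZl.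
rewrite [X in (_ + (X + _))%E]big1 ?add0e; last first.
  by move=> i _; rewrite integralZl// eX mule0.
rewrite [X in (_ + X = _)%E](_ : _ = (c ^+ 2)%:E); last first.
  transitivity ((c ^+ 2)%:E * P setT)%E; first exact: integral_cst.
  by rewrite probability_setT mule1.
rewrite EFinD; congr (_ + _)%E.
transitivity (\sum_i \sum_j (a i * a j * (if i == j then 1 else rho))%:E)%E.
  apply: eq_bigr => i _; rewrite integral_sum//; last by move=> j; exact: integrableZl.
  by apply: eq_bigr => j _; rewrite integralZl// eXX EFinM.
under eq_bigr => i _ do rewrite sumEFin.
rewrite sumEFin; congr _%:E; rewrite /equi_var.
rewrite [in X in _ = _ + rho * X]expr2 big_distrlr/= !mulr_sumr -big_split/=.
apply: eq_bigr => i _.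
rewrite mulr_sumr (bigD1 i)//= eqxx [in RHS](bigD1 i)//= addrA; congr (_ + _); first ring.
by apply: eq_bigr => j; rewrite eq_sym => /negbTE ->; ring.
Qed.

Lemma equicorrelated_cos (a : 'I_n -> R) (c : R) :
  \int[P]_w cos (\sum_i a i * X i w + c) = cos c * expR (- (equi_var a / 2)).
Proof.
have [mn _ _ _] := hX.
have [m [s [s0 Pa]]] := mn a.
have mW : measurable_fun setT (fun w => \sum_i a i * X i w).
  apply: measurable_sum => i; exact: measurable_funM.
pose W : {mfun T >-> R} := HB.pack (fun w => \sum_i a i * X i w)
  (isMeasurableFun.Build _ _ _ _ _ mW).
have WG := normal_law_integral (W := W) s0 Pa.
have sq b : (m + b) ^+ 2 + s ^+ 2 = equi_var a + b ^+ 2.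
  have cG : continuous (fun x : R => (x + b) ^+ 2).
    move=> x; apply: (cvg_comp (fun x => x + b) (fun x => x ^+ 2)).
      by apply: cvgD; [exact: cvg_id|exact: cvg_cst].
    exact: exprn_continuous.
  have := congr1 fine (WG _ cG (fun x => sqr_ge0 _)).
  rewrite second_moment/= => ->; rewrite -(std_pdf_sqr_affine (m + b) s).
  by apply: eq_Rintegral => x _; rewrite addrAC.
(* The first two moments identify the parameters of the law of W. *)
have m0 : m = 0 by have := sq 0; have := sq 1; nra.
have s2 : s ^+ 2 = equi_var a by have := sq 0; rewrite m0; nra.
have ccos : continuous (fun x : R => cos (x + c)).
  move=> x; apply: (cvg_comp (fun x => x + c) cos).
    by apply: cvgD; [exact: cvg_id|exact: cvg_cst].
  exact: continuous_cos.
(* Adding 1 makes the integrand nonnegative, as [normal_law_integral] requires; the 1 is subtracted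
   again afterwards. *)
have cG : continuous (fun x : R => cos (x + c) + 1).
  by move=> x; apply: cvgD; [exact: ccos|exact: cvg_cst].
have G0 (x : R) : 0 <= cos (x + c) + 1 by have := cos_geN1 (x + c); lra.
have := congr1 fine (WG _ cG G0).
have i1 : P.-integrable setT (EFin \o (fun w => cos (W w + c))).
  apply: (@bounded_integrable _ _ _ _ _ 1) => [|w].
    apply: (measurableT_comp (f := fun x : R => cos (x + c))) => //.
    exact: continuous_measurable_fun.
  by rewrite ler_norml cos_geN1 cos_le1.
rewrite -[LHS]/(\int[P]_w (cos (W w + c) + 1)).
rewrite (RintegralD measurableT i1 (finite_measure_integrable_cst P 1 measurableT)).
rewrite -[X in _ + X = _]/(\int[P]_w (cst 1) w) probability_Rintegral_cst.
move=> /esym/eqP; rewrite -subr_eq => /eqP.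
rewrite -[X in X - 1 = _]/(\int[mu]_x ((cos (m + s * x + c) + 1) * std_pdf x)).
have -> : \int[mu]_x ((cos (m + s * x + c) + 1) * std_pdf x) =
    \int[mu]_x (cos (s * x + c) * std_pdf x + std_pdf x).
  by apply: eq_Rintegral => x _; rewrite m0 add0r mulrDl mul1r.
rewrite (RintegralD measurableT (integrable_cos_std_pdf s c) (integrable_std_pdf R)).
rewrite [X in _ + X - 1]/Rintegral integral_std_pdf/= addrK std_pdf_cos s2 => <-.
by [].
Qed.

End equicorrelated.

(** * Bounded measurable functions *)

Section bounded_measurable.
Context (R : realType) d (T : measurableType d) (P : probability T R).

(** A class stable under finite sums and products and integrable for every probability, so that
    integrals can be expanded freely. *)
Definition bounded_measurable (f : T -> R) :=
  measurable_fun setT f /\ exists M, forall w, `|f w| <= M.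

Lemma bounded_measurable_integrable f :
  bounded_measurable f -> P.-integrable setT (EFin \o f).
Proof. by move=> [mf [M fM]]; exact: bounded_integrable mf fM. Qed.

Lemma bounded_measurableM f g : bounded_measurable f -> bounded_measurable g ->
  bounded_measurable (fun w => f w * g w).
Proof.
move=> [mf [M fM]] [mg [N gN]]; split; first exact: measurable_funM.
by exists (M * N) => w; rewrite normrM ler_pM.
Qed.

Lemma bounded_measurable_prod (I : Type) (r : seq I) (f : I -> T -> R) :
  (forall i, bounded_measurable (f i)) ->
  bounded_measurable (fun w => \prod_(i <- r) f i w).
Proof.
move=> bf; elim: r => [|i r IH].
  under eq_fun do rewrite big_nil.
  by split=> //; exists 1 => w; rewrite normr1.
by under eq_fun do rewrite big_cons; exact: bounded_measurableM.
Qed.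

Lemma bounded_measurable_sum (I : Type) (r : seq I) (f : I -> T -> R) :
  (forall i, bounded_measurable (f i)) ->
  bounded_measurable (fun w => \sum_(i <- r) f i w).
Proof.
move=> bf; elim: r => [|i r [mIH [M IH]]].
  under eq_fun do rewrite big_nil.
  by split=> //; exists 0 => w; rewrite normr0.
under eq_fun do rewrite big_cons.
have [mf [N fN]] := bf i; split; first exact: measurable_funD.
by exists (N + M) => w; rewrite (le_trans (ler_normD _ _))// lerD.
Qed.

Lemma Rintegral_lin_comb (I : Type) (r : seq I) (c : I -> R) (f : I -> T -> R) :
  (forall i, bounded_measurable (f i)) ->
  \int[P]_w (\sum_(i <- r) c i * f i w) = \sum_(i <- r) c i * \int[P]_w f i w.
Proof.
move=> bf; have bcst k : bounded_measurable (cst k).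
  by split=> //; exists `|k|.
elim: r => [|i r IH].
  under eq_Rintegral do rewrite big_nil.
  by rewrite probability_Rintegral_cst big_nil.
under eq_Rintegral do rewrite big_cons.
rewrite RintegralD//; last 2 first.
- exact/bounded_measurable_integrable/(bounded_measurableM (bcst _) (bf i)).
- apply/bounded_measurable_integrable/bounded_measurable_sum => j.
  exact: (bounded_measurableM (bcst _) (bf j)).
by rewrite IH big_cons RintegralZl//; exact: bounded_measurable_integrable.
Qed.

End bounded_measurable.

Section std_normal.
Context (R : realType).
Local Notation mu := (@lebesgue_measure R).
Local Notation N := (normal_prob (0:R) 1).

Lemma std_normal_Rintegral (f : R -> R) : bounded_measurable f ->
  \int[N]_x f x = \int[mu]_x (f x * std_pdf x).
Proof.
move=> [mf [M fM]].
have D (g : R -> R) : measurable_fun setT g -> (forall x, 0 <= g x) ->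
    (\int[N]_x (g x)%:E = \int[mu]_x (g x * std_pdf x)%:E)%E.
  move=> mg g0; rewrite -std_pdfE; apply: ge0_integral_density => //.
  - exact: measurable_normal_pdf.
  - by move=> x; exact: normal_pdf_ge0.
(* The change of density is available for nonnegative functions; the bound [M] shifts [f] into that
   range. *)
have mfM : measurable_fun setT (fun x => f x + M) by exact: measurable_funD.
have fM0 x : 0 <= f x + M by have := fM x; rewrite ler_norml; lra.
have := congr1 fine (D _ mfM fM0).
rewrite -[LHS]/(\int[N]_x (f x + M)) -[RHS]/(\int[mu]_x ((f x + M) * std_pdf x)).
have if_ := bounded_integrable N mf fM.
rewrite (RintegralD measurableT if_ (finite_measure_integrable_cst N M measurableT)).
rewrite -[X in _ + X = _]/(\int[N]_x (cst M) x) probability_Rintegral_cst.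
have -> : \int[mu]_x ((f x + M) * std_pdf x) =
    \int[mu]_x (f x * std_pdf x + M * std_pdf x).
  by apply: eq_Rintegral => x _; rewrite mulrDl.
have i1 : mu.-integrable setT (EFin \o (fun x => f x * std_pdf x)).
  apply: (integrable_std_pdfM (c := M)) => // x.
  rewrite (le_trans (fM x))// ler_peMr ?ge1_expRsqr4//.
  exact: le_trans (fM 0).
have i2 : mu.-integrable setT (EFin \o (fun x => M * std_pdf x)).
  exact: (integrableZl measurableT M (integrable_std_pdf R)).
rewrite (RintegralD measurableT i1 i2) (RintegralZl M measurableT (integrable_std_pdf R)).
by rewrite [X in _ + _ * X]/Rintegral integral_std_pdf/= mulr1 => /addIr.
Qed.

Lemma bounded_measurable_cos (a b : R) : bounded_measurable (fun x : R => cos (a * x + b)).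
Proof.
split; first by apply: continuous_measurable_fun; exact: continuous_cos_affine.
by exists 1 => x; rewrite ler_norml cos_geN1 cos_le1.
Qed.

Lemma std_normal_cos (a b : R) :
  \int[N]_x cos (a * x + b) = cos b * expR (- (a ^+ 2 / 2)).
Proof.
rewrite std_normal_Rintegral; last exact: bounded_measurable_cos.
exact: std_pdf_cos.
Qed.

End std_normal.

(** * Trigonometric polynomials and the product formula *)

Section trig_poly.
Context (R : realType).
Local Notation N := (normal_prob (0:R) 1).

(* The triples are (amplitude, frequency, phase). *)
Definition trig_poly (l : seq (R * R * R)) (x : R) : R :=
  \sum_(p <- l) p.1.1 * cos (p.1.2 * x + p.2).

(* The conditional expectation of h (X i) given the common factor y in the
   representation X i = sqrt rho * y + sqrt (1 - rho) * z i. *)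
Definition gauss_avg (rho : R) (h : R -> R) (y : R) : R :=
  \int[N]_z h (Num.sqrt rho * y + Num.sqrt (1 - rho) * z).

(** Averaging over z multiplies each term by a Gaussian factor in its frequency, so the result is
    again a trigonometric polynomial in y. *)
Lemma gauss_avg_trig_poly (rho : R) l y : rho <= 1 ->
  gauss_avg rho (trig_poly l) y =
  \sum_(p <- l) (p.1.1 * expR (- ((1 - rho) * p.1.2 ^+ 2 / 2))) *
    cos (p.1.2 * Num.sqrt rho * y + p.2).
Proof.
move=> rho1; rewrite /gauss_avg /trig_poly.
have E (p : R * R * R) z : p.1.2 * (Num.sqrt rho * y + Num.sqrt (1 - rho) * z) + p.2 =
   (p.1.2 * Num.sqrt (1 - rho)) * z + (p.1.2 * Num.sqrt rho * y + p.2) by ring.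
under eq_Rintegral => z _ do under eq_bigr do rewrite E.
rewrite Rintegral_lin_comb; last by move=> p; exact: bounded_measurable_cos.
apply: eq_bigr => p _; rewrite std_normal_cos exprMn sqr_sqrtr ?subr_ge0//.
by rewrite (mulrC (1 - rho)); ring.
Qed.

Lemma bounded_measurable_trig_poly l : bounded_measurable (trig_poly l).
Proof.
apply: bounded_measurable_sum => p; apply: bounded_measurableM.
  by split => //; exists `|p.1.1|.
exact: bounded_measurable_cos.
Qed.

End trig_poly.

Section single_update.
Context (R : realType) (n : nat).
Implicit Types (v x : 'I_n -> R) (i : 'I_n) (e : R).

(** The effect on the frequency vector of multiplying by a cosine of frequency [e] in X_i. *)
Definition add_at v i e (j : 'I_n) : R := v j + e * (j == i)%:R.

Lemma sum_add_atM v i e x :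
  \sum_j add_at v i e j * x j = \sum_j v j * x j + e * x i.
Proof.
under eq_bigr do rewrite mulrDl.
rewrite big_split/=; congr (_ + _).
rewrite (bigD1 i)//= eqxx mulr1 big1 ?addr0// => j /negbTE ->.
by rewrite mulr0 mul0r.
Qed.

Lemma sum_add_at v i e : \sum_j add_at v i e j = \sum_j v j + e.
Proof.
rewrite -[RHS]addr0 -[X in _ + X](subrr e).
have := sum_add_atM v i e (fun=> 1); under eq_bigr do rewrite mulr1.
by under [in RHS]eq_bigr do rewrite mulr1; rewrite mulr1 subrr addr0.
Qed.

(** There is no cross term because [v i = 0]; this is what makes the Gaussian factors multiply in
    the product formula. *)
Lemma sum_sqr_add_at v i e : v i = 0 ->
  \sum_j add_at v i e j ^+ 2 = \sum_j v j ^+ 2 + e ^+ 2.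
Proof.
move=> vi; rewrite (bigD1 i)//= [in RHS](bigD1 i)//= /add_at vi eqxx.
rewrite mulr1 add0r expr0n/= add0r addrC; congr (_ + _).
by apply: eq_bigr => j /negbTE ->; rewrite mulr0 addr0.
Qed.

End single_update.

Section factorization.
Context (R : realType) d (T : measurableType d) (P : probability T R) (n : nat)
  (rho : R) (X : 'I_n -> {RV P >-> R}).
Hypothesis rho01 : 0 < rho < 1.
Hypothesis hX : equicorrelated_normal rho X.
Local Notation N := (normal_prob (0:R) 1).

Lemma bounded_measurable_comp (f : R -> R) (g : T -> R) :
  bounded_measurable f -> measurable_fun setT g ->
  bounded_measurable (fun w => f (g w)).
Proof.
move=> [mf [M fM]] mg; split; first exact: measurableT_comp.
by exists M => w; exact: fM.
Qed.

Let bmcos (v : 'I_n -> R) c :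
  bounded_measurable (fun w => cos (\sum_j v j * X j w + c)).
Proof.
apply: (@bounded_measurable_comp (fun x => cos (x + c))).
  have := bounded_measurable_cos (1 : R) c.
  by under eq_fun do rewrite mul1r.
by apply: measurable_sum => i; exact: measurable_funM.
Qed.

Let coscos (x y : R) : cos x * cos y = 2^-1 * (cos (x + y) + cos (x - y)).
Proof. by rewrite cosD cosB; field. Qed.

(* The extra cosine makes the induction on r go through: product-to-sum moves
   each term of a factor h (X i) into the frequency vector v. *)
Lemma equicorrelated_trig_poly_prod l (r : seq 'I_n) : uniq r ->
  forall (v : 'I_n -> R) c, (forall i, i \in r -> v i = 0) ->
  \int[P]_w (cos (\sum_j v j * X j w + c) * \prod_(i <- r) trig_poly l (X i w)) =
  \int[N]_y (expR (- ((1 - rho) * (\sum_j v j ^+ 2) / 2)) *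
    (cos (Num.sqrt rho * (\sum_j v j) * y + c) *
     \prod_(i <- r) gauss_avg rho (trig_poly l) y)).
Proof.
have [rho0 rho1] := andP rho01.
have bmtrig i : bounded_measurable (fun w => trig_poly l (X i w)).
  by apply: bounded_measurable_comp => //; exact: bounded_measurable_trig_poly.
have bmavg : bounded_measurable (gauss_avg rho (trig_poly l)).
  rewrite (_ : gauss_avg _ _ = (fun y => \sum_(p <- l)
    (p.1.1 * expR (- ((1 - rho) * p.1.2 ^+ 2 / 2))) *
    cos (p.1.2 * Num.sqrt rho * y + p.2))); last first.
    by apply/funext => y; rewrite gauss_avg_trig_poly// ltW.
  apply: bounded_measurable_sum => p; apply: bounded_measurableM.
    by split=> //; exists `|p.1.1 * expR (- ((1 - rho) * p.1.2 ^+ 2 / 2))|.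
  exact: bounded_measurable_cos.
elim: r => [_ v c _|i r IH /= /andP[ir ur] v c v0].
  under eq_Rintegral do rewrite big_nil mulr1.
  rewrite (equicorrelated_cos hX).
  under [RHS]eq_Rintegral do rewrite big_nil mulr1.
  rewrite RintegralZl//; last first.
    exact/bounded_measurable_integrable/bounded_measurable_cos.
  (* The two parts of [equi_var v] separate: (1 - rho) times the sum of squares is the prefactor,
     and rho times the squared sum is the cosine transform in y. *)
  rewrite std_normal_cos mulrCA -expRD; congr (_ * expR _).
  rewrite exprMn sqr_sqrtr ?ltW// /equi_var.
  by set S2 := \sum_j v j ^+ 2; set S1 := \sum_j v j; field.
(* [F1] and [F2] are the sum and difference terms of the outer cosine times the term [p] of the
   factor at [i]; [G1] and [G2] are their images under the induction hypothesis. *)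
pose F1 (p : R * R * R) w := cos (\sum_j add_at v i p.1.2 j * X j w + (c + p.2)) *
  \prod_(i <- r) trig_poly l (X i w).
pose F2 (p : R * R * R) w := cos (\sum_j add_at v i (- p.1.2) j * X j w + (c - p.2)) *
  \prod_(i <- r) trig_poly l (X i w).
pose G1 (p : R * R * R) y := expR (- ((1 - rho) * (\sum_j add_at v i p.1.2 j ^+ 2) / 2)) *
    (cos (Num.sqrt rho * (\sum_j add_at v i p.1.2 j) * y + (c + p.2)) *
     \prod_(i <- r) gauss_avg rho (trig_poly l) y).
pose G2 (p : R * R * R) y := expR (- ((1 - rho) * (\sum_j add_at v i (- p.1.2) j ^+ 2) / 2)) *
    (cos (Num.sqrt rho * (\sum_j add_at v i (- p.1.2) j) * y + (c - p.2)) *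
     \prod_(i <- r) gauss_avg rho (trig_poly l) y).
have bF1 p : bounded_measurable (F1 p).
  by apply: bounded_measurableM; [exact: bmcos|exact: bounded_measurable_prod].
have bF2 p : bounded_measurable (F2 p).
  by apply: bounded_measurableM; [exact: bmcos|exact: bounded_measurable_prod].
have bcst k : @bounded_measurable R _ (measurableTypeR R) (cst k).
  by split=> //; exists `|k|.
have bG1 p : @bounded_measurable R _ (measurableTypeR R) (G1 p).
  apply: (bounded_measurableM (bcst _)); apply: bounded_measurableM.
    exact: bounded_measurable_cos.
  exact: bounded_measurable_prod.
have bG2 p : @bounded_measurable R _ (measurableTypeR R) (G2 p).
  apply: (bounded_measurableM (bcst _)); apply: bounded_measurableM.
    exact: bounded_measurable_cos.
  exact: bounded_measurable_prod.
have bD d' (S : measurableType d') (f g : S -> R) : bounded_measurable f ->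
    bounded_measurable g -> bounded_measurable (fun w => f w + g w).
  move=> [mf [M fM]] [mg [M' gM]]; split; first exact: measurable_funD.
  by exists (M + M') => w; rewrite (le_trans (ler_normD _ _))// lerD.
have iF p : \int[P]_w (F1 p w + F2 p w) = \int[N]_y (G1 p y + G2 p y).
  rewrite RintegralD//; [|exact: bounded_measurable_integrable..].
  rewrite RintegralD//; [|exact: bounded_measurable_integrable..].
  (* Since [i] does not occur in [r], the updated vector still vanishes on [r]. *)
  have vr e : forall j, j \in r -> add_at v i e j = 0.
    move=> j jr; rewrite /add_at v0 ?inE ?jr ?orbT// add0r.
    by case: eqP => [ji|]; [rewrite -ji jr in ir|rewrite mulr0].
  by congr (_ + _); exact: (IH ur _ _ (vr _)).
transitivity (\int[P]_w \sum_(p <- l) (2^-1 * p.1.1) * (F1 p w + F2 p w)).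
  apply: eq_Rintegral => w _; rewrite big_cons mulrA {1}/trig_poly mulr_sumr mulr_suml.
  apply: eq_bigr => p _; rewrite mulrCA coscos /F1 /F2 !sum_add_atM.
  have -> : \sum_j v j * X j w + p.1.2 * X i w + (c + p.2) =
    \sum_j v j * X j w + c + (p.1.2 * X i w + p.2) by ring.
  have -> : \sum_j v j * X j w + - p.1.2 * X i w + (c - p.2) =
    \sum_j v j * X j w + c - (p.1.2 * X i w + p.2) by ring.
  by ring.
rewrite Rintegral_lin_comb; last by move=> p; exact: bD.
rewrite (eq_bigr (fun p => 2^-1 * p.1.1 * \int[N]_y (G1 p y + G2 p y))); last first.
  by move=> p _; congr (_ * _); exact: iF.
rewrite -(Rintegral_lin_comb N) /=; last by move=> p; exact: bD.
apply: eq_Rintegral => y _; rewrite big_cons.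
set A0 := expR _; set C0 := cos _.
rewrite {1}gauss_avg_trig_poly ?ltW// mulr_suml !mulr_sumr.
apply: eq_bigr => p _; rewrite /A0 /C0 /G1 /G2 !sum_add_at !sum_sqr_add_at ?v0 ?mem_head//.
rewrite sqrrN.
set S2 := \sum_j v j ^+ 2; set S1 := \sum_j v j.
(* The second exponent is the factor that [gauss_avg] attaches to the term [p]. *)
have -> : - ((1 - rho) * (S2 + p.1.2 ^+ 2) / 2) =
  - ((1 - rho) * S2 / 2) + - ((1 - rho) * p.1.2 ^+ 2 / 2) by field.
rewrite expRD.
have -> : Num.sqrt rho * (S1 + p.1.2) * y + (c + p.2) =
  Num.sqrt rho * S1 * y + c + (p.1.2 * Num.sqrt rho * y + p.2) by ring.
have -> : Num.sqrt rho * (S1 - p.1.2) * y + (c - p.2) =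
  Num.sqrt rho * S1 * y + c - (p.1.2 * Num.sqrt rho * y + p.2) by ring.
set u := Num.sqrt rho * S1 * y + c; set w := p.1.2 * Num.sqrt rho * y + p.2.
set A := expR (- ((1 - rho) * S2 / 2)); set Q := \prod_(i <- r) _.
set B := expR (- ((1 - rho) * p.1.2 ^+ 2 / 2)).
transitivity (A * p.1.1 * B * Q * (cos u * cos w)); first by rewrite coscos; ring.
by ring.
Qed.

End factorization.

Section trig_poly_closure.
Context (R : realType).
Implicit Types (f g : R -> R).

Definition is_trig_poly f := exists l, f = trig_poly l.

Lemma is_trig_polyD f g : is_trig_poly f -> is_trig_poly g ->
  is_trig_poly (fun x => f x + g x).
Proof.
move=> [l ->] [l' ->]; exists (l ++ l').
by apply/funext => x; rewrite /trig_poly big_cat.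
Qed.

Lemma is_trig_poly_sum (I : Type) (r : seq I) (f : I -> R -> R) :
  (forall i, is_trig_poly (f i)) -> is_trig_poly (fun x => \sum_(i <- r) f i x).
Proof.
move=> tf; elim: r => [|i r IH].
  by exists [::]; apply/funext => x; rewrite /trig_poly !big_nil.
by under eq_fun do rewrite big_cons; exact: is_trig_polyD.
Qed.

Lemma is_trig_poly_cos c a b : is_trig_poly (fun x => c * cos (a * x + b)).
Proof. by exists [:: (c, a, b)]; apply/funext => x; rewrite /trig_poly big_seq1. Qed.

Lemma is_trig_polyM f g : is_trig_poly f -> is_trig_poly g ->
  is_trig_poly (fun x => f x * g x).
Proof.
move=> [l ->] [l' ->].
rewrite (_ : (fun _ => _) = (fun x => \sum_(p <- l) \sum_(q <- l')
   (p.1.1 * q.1.1 / 2 * cos ((p.1.2 + q.1.2) * x + (p.2 + q.2)) +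
    p.1.1 * q.1.1 / 2 * cos ((p.1.2 - q.1.2) * x + (p.2 - q.2))))).
  apply: is_trig_poly_sum => p; apply: is_trig_poly_sum => q.
  by apply: is_trig_polyD; exact: is_trig_poly_cos.
apply/funext => x; rewrite /trig_poly mulr_suml; apply: eq_bigr => p _.
rewrite mulr_sumr; apply: eq_bigr => q _.
have -> : (p.1.2 + q.1.2) * x + (p.2 + q.2) = (p.1.2 * x + p.2) + (q.1.2 * x + q.2) by ring.
have -> : (p.1.2 - q.1.2) * x + (p.2 - q.2) = (p.1.2 * x + p.2) - (q.1.2 * x + q.2) by ring.
set u := p.1.2 * x + p.2; set w := q.1.2 * x + q.2.
by rewrite (cosD u w) (cosB u w); field.
Qed.

Lemma is_trig_poly_cst c : is_trig_poly (cst c).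
Proof.
by have := is_trig_poly_cos c 0 0; under eq_fun do rewrite mul0r add0r cos0 mulr1.
Qed.

Lemma is_trig_poly_sin a : is_trig_poly (fun x => sin (a * x)).
Proof.
have := is_trig_poly_cos (-1) a (pi / 2).
by under eq_fun do rewrite cosDpihalf mulN1r opprK.
Qed.

End trig_poly_closure.

(** * Approximation of the sign *)

Section sign_approximation.
Context (R : realType).
Implicit Types (s x : R).

(* Polynomial, hence preserving trigonometric polynomials, with iterates tending
   to the sign on [-1, 1]. *)
Definition sign_step s : R := (3 * s - s ^+ 3) / 2.

Lemma sign_stepN s : sign_step (- s) = - sign_step s.
Proof. by rewrite /sign_step; field. Qed.

Lemma iter_sign_stepN k s : iter k sign_step (- s) = - iter k sign_step s.
Proof. by elim: k => //= k ->; exact: sign_stepN. Qed.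

(** From 1 - [sign_step t] = (1 - t)^2 (2 + t) / 2, one step multiplies the distance to 1 by 1 - t
    (1 + t) / 2, which is at most 1 - s / 2 because the iterates stay above [s]. *)
Lemma iter_sign_step_ge0 k s : 0 <= s <= 1 ->
  s <= iter k sign_step s <= 1 /\ 1 - iter k sign_step s <= (1 - s / 2) ^+ k.
Proof.
move=> /andP[s0 s1]; elim: k => [|k [/andP[a b] c]] /=.
  by rewrite lexx s1 expr0; split=> //; lra.
set t := iter k _ s in a b c *; rewrite /sign_step.
have t0 : 0 <= t by exact: le_trans a.
have t1 : 0 <= t * ((1 - t) * (1 + t)) by rewrite mulr_ge0// mulr_ge0; lra.
have t2 : 0 <= (1 - t) ^+ 2 * (2 + t) by rewrite mulr_ge0 ?sqr_ge0//; lra.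
split; first by apply/andP; split; lra.
rewrite [leRHS]exprS.
have s2 : 0 <= 1 - s / 2 by lra.
apply: (@le_trans _ _ ((1 - s / 2) * (1 - t))); last exact: ler_wpM2l.
have : 0 <= (1 - t) * ((t - s) + t ^+ 2).
  by rewrite mulr_ge0 ?subr_ge0// addr_ge0 ?subr_ge0 ?sqr_ge0.
by lra.
Qed.

Lemma norm_iter_sign_step_le1 k s : `|s| <= 1 -> `|iter k sign_step s| <= 1.
Proof.
rewrite !ler_norml; have [s0|s0] := leP 0 s => /andP[sm1 s1].
  by have [|/andP[a b] _] := @iter_sign_step_ge0 k s; lra.
have [|/andP[a b] _] := @iter_sign_step_ge0 k (- s); first lra.
by move: a b; rewrite iter_sign_stepN; lra.
Qed.

Lemma cvg_iter_sign_step s : `|s| <= 1 ->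
  iter k sign_step s @[k --> \oo] --> Num.sg s.
Proof.
have pos (t : R) : 0 < t <= 1 -> iter k sign_step t @[k --> \oo] --> (1 : R).
  move=> /andP[t0 t1].
  apply: (@squeeze_cvgr _ _ _ _ (fun k => 1 - (1 - t / 2) ^+ k) (cst 1)).
  - near=> k; have [|/andP[_ b] c] := @iter_sign_step_ge0 k t; first lra.
    by rewrite b andbT; lra.
  - rewrite -[X in _ --> X]subr0; apply: cvgB; first exact: cvg_cst.
    by apply: cvg_expr; rewrite ger0_norm; lra.
  - exact: cvg_cst.
rewrite ler_norml => /andP[sm1 s1]; have [s0|s0|->] := ltgtP s 0.
- rewrite ltr0_sg// -[s]opprK; under eq_fun do rewrite iter_sign_stepN.
  by apply: cvgN; apply: pos; lra.
- by rewrite gtr0_sg//; apply: pos; lra.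
- have z k : iter k sign_step 0 = 0 :> R.
    by elim: k => //= k ->; rewrite /sign_step; field.
  by rewrite sgr0; under eq_fun do rewrite z; exact: cvg_cst.
Unshelve. all: end_near. Qed.

(** The sign agrees with that of [x] as soon as |x| < (m + 1) pi, so the sequence is eventually
    constant. *)
Lemma cvg_sg_sin_div x : Num.sg (sin (m.+1%:R^-1 * x)) @[m --> \oo] --> Num.sg x.
Proof.
have pos (t : R) : 0 < t -> \forall m \near \oo, Num.sg (sin (m.+1%:R^-1 * t)) = 1.
  move=> t0; near=> m; rewrite gtr0_sg// sin_gt0_pi// mulr_gt0//=.
  rewrite mulrC ltr_pdivrMr// -ltr_pdivrMl ?pi_gt0//.
  rewrite (@lt_le_trans _ _ m%:R) ?ler_nat//.
  by near: m; exact: nbhs_infty_gtr.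
apply: cvg_near_cst; have [x0|x0|->] := ltgtP x 0.
- have := pos (- x); rewrite oppr_gt0 => /(_ x0); apply: filterS => m.
  rewrite mulrN sinN sgrN => h; apply: oppr_inj.
  by rewrite h (ltr0_sg x0) opprK.
- by have := pos x x0; apply: filterS => m ->; rewrite gtr0_sg.
- by near=> m; rewrite mulr0 sin0.
Unshelve. all: end_near. Qed.

End sign_approximation.

(** * Passage from trigonometric polynomials to the orthant *)

Section orthant.
Context (R : realType) d (T : measurableType d) (P : probability T R) (n : nat)
  (rho : R) (X : 'I_n -> {RV P >-> R}).
Hypothesis rho01 : 0 < rho < 1.
Hypothesis hX : equicorrelated_normal rho X.
Local Notation N := (normal_prob (0:R) 1).

(** The property carried through the limits. The bound by 1 supplies the dominating function and,
    like measurability, passes to pointwise limits. *)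
Let factorizes (h : R -> R) :=
  [/\ measurable_fun setT h, forall x, `|h x| <= 1,
      measurable_fun setT (gauss_avg rho h) &
      \int[P]_w (\prod_i h (X i w)) = \int[N]_y gauss_avg rho h y ^+ n].

Let norm_prod_le1 (f : 'I_n -> R) : (forall i, `|f i| <= 1) -> `|\prod_i f i| <= 1.
Proof.
move=> f1; rewrite normr_prod; apply: (@le_trans _ _ (\prod_(i < n) 1)).
  by apply: ler_prod => i _; rewrite f1 normr_ge0.
by rewrite big1.
Qed.

Let affine (y z : R) : R := Num.sqrt rho * y + Num.sqrt (1 - rho) * z.

Let measurable_affine y : measurable_fun setT (affine y).
Proof. by apply: measurable_funD => //; exact: measurable_funM. Qed.

Let norm_gauss_avg_le1 (h : R -> R) (y : R) : measurable_fun setT h -> (forall x, `|h x| <= 1) ->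
  `|gauss_avg rho h y| <= 1.
Proof.
move=> mh h1.
have mha : measurable_fun setT (fun z => h (affine y z)).
  by apply: measurableT_comp => //; exact: measurable_affine.
rewrite (le_trans (le_normr_Rintegral _ _))//.
  by apply: (bounded_integrable N mha (M := 1)).
rewrite -[leRHS](probability_Rintegral_cst N 1); apply: le_Rintegral => //.
  apply: (bounded_integrable N (M := 1)) => [|w].
    exact: measurableT_comp.
  by rewrite normr_id.
exact: finite_measure_integrable_cst.
Qed.

(** Dominated convergence acts three times, with the constant 1: in the average over z, for the
    product under [P], and for the n-th power in y. *)
Let factorizes_lim (h_ : nat -> R -> R) (h : R -> R) : (forall k, factorizes (h_ k)) ->
  (forall x, h_ k x @[k --> \oo] --> h x) -> factorizes h.
Proof.
move=> fh hh.
have mh : measurable_fun setT h.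
  by apply: (measurable_fun_cvg (h := h_)) => [k|x _]; [have [] := fh k|exact: hh].
have h1 x : `|h x| <= 1.
  have /cvg_norm hx := hh x.
  rewrite -(cvg_lim _ hx)//; apply: limr_le; first by apply: cvgP hx.
  by near=> k; have [_ + _ _] := fh k.
have ha y : gauss_avg rho (h_ k) y @[k --> \oo] --> gauss_avg rho h y.
  apply: (bounded_cvg_Rintegral (M := 1)) => [k|k z|z].
  - by have [mhk _ _ _] := fh k; apply: measurableT_comp => //; exact: measurable_affine.
  - by have [_ + _ _] := fh k.
  - exact: hh.
split => //.
  apply: (measurable_fun_cvg (h := fun k => gauss_avg rho (h_ k))) => [k|y _].
    by have [] := fh k.
  exact: ha.
have cprod (f_ : nat -> 'I_n -> R) (f : 'I_n -> R) :
    (forall i, f_ k i @[k --> \oo] --> f i) ->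
    \prod_i f_ k i @[k --> \oo] --> \prod_i f i.
  move=> ff; elim: (index_enum _) => [|i r IH].
    by rewrite big_nil; under eq_fun do rewrite big_nil; exact: cvg_cst.
  by rewrite big_cons; under eq_fun do rewrite big_cons; exact: cvgM.
have c1 : \int[P]_w (\prod_i h_ k (X i w)) @[k --> \oo] --> \int[P]_w (\prod_i h (X i w)).
  apply: (bounded_cvg_Rintegral (M := 1)) => [k|k w|w].
  - by have [mhk _ _ _] := fh k; apply: measurable_prod => i _; exact: measurableT_comp.
  - by apply: norm_prod_le1 => i; have [_ + _ _] := fh k.
  - by apply: cprod => i; exact: hh.
have c2 : \int[N]_y (gauss_avg rho (h_ k) y ^+ n) @[k --> \oo] -->
    \int[N]_y (gauss_avg rho h y ^+ n).
  apply: (bounded_cvg_Rintegral (M := 1)) => [k|k y|y].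
  - by have [_ _ mk _] := fh k; exact: measurable_funX.
  - have [mk k1 _ _] := fh k; rewrite normrX exprn_ile1//.
    exact: norm_gauss_avg_le1.
  - exact: (cvg_comp _ _ (ha y) (@exprn_continuous R n _)).
apply: cvg_unique c1 _ => //.
rewrite (_ : (fun k => _) = (fun k => \int[N]_y (gauss_avg rho (h_ k) y ^+ n)))//.
by apply/funext => k; have [] := fh k.
Unshelve. all: end_near. Qed.

Let factorizes_trig_poly (h : R -> R) : is_trig_poly h -> (forall x, `|h x| <= 1) -> factorizes h.
Proof.
move=> [l ->] h1; have [rho0 rho1] := andP rho01.
have [ml _] := bounded_measurable_trig_poly l.
split => //.
  rewrite (_ : gauss_avg _ _ = (fun y => \sum_(p <- l)
    (p.1.1 * expR (- ((1 - rho) * p.1.2 ^+ 2 / 2))) *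
    cos (p.1.2 * Num.sqrt rho * y + p.2))); last first.
    by apply/funext => y; rewrite gauss_avg_trig_poly// ltW.
  apply: measurable_sum => p; apply: measurable_funM => //.
  by have [] := bounded_measurable_cos (p.1.2 * Num.sqrt rho) p.2.
have := equicorrelated_trig_poly_prod rho01 hX l (index_enum_uniq 'I_n)
  (v := fun=> 0) 0 (fun _ _ => erefl).
have E1 w : cos (\sum_(j < n) 0 * X j w + 0) * \prod_i trig_poly l (X i w) =
    \prod_i trig_poly l (X i w).
  by rewrite addr0 big1 ?cos0 ?mul1r// => i _; rewrite mul0r.
have E2 y : expR (- ((1 - rho) * (\sum_(j < n) 0 ^+ 2) / 2)) *
    (cos (Num.sqrt rho * (\sum_(j < n) 0) * y + 0) *
     \prod_(i < n) gauss_avg rho (trig_poly l) y) = gauss_avg rho (trig_poly l) y ^+ n.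
  rewrite big1 => [|i _]; last by rewrite expr0n.
  rewrite big1 => [|//]; rewrite !mulr0 !mul0r oppr0 expR0 addr0 cos0 !mul1r.
  by rewrite prodr_const card_ord.
under eq_Rintegral do rewrite E1.
by under [in RHS]eq_Rintegral do rewrite E2.
Qed.

(** If s is the sign of x, then (s + s^2) / 2 is the indicator of x > 0, with the right value 0 at x
    = 0. The inner limit, in [k], turns iterates of [sign_step] into the sign of a sine; the outer
    one, in [m], turns that into the sign of x. On [-1, 1] the map [half] stays bounded by 1. *)
Let factorizes_pos : factorizes (fun x => (0 < x)%R%:R).
Proof.
have trig (m k : nat) : is_trig_poly (fun x : R => iter k (@sign_step R) (sin (m.+1%:R^-1 * x))).
  elim: k => [|k IH] /=; first exact: is_trig_poly_sin.
  rewrite (_ : (fun _ => _) = (fun x => (cst (3 / 2 : R)) x * iter k (@sign_step R) (sin (m.+1%:R^-1 * x)) +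
    (cst (- 2^-1 : R)) x * (iter k (@sign_step R) (sin (m.+1%:R^-1 * x)) *
    (iter k (@sign_step R) (sin (m.+1%:R^-1 * x)) * iter k (@sign_step R) (sin (m.+1%:R^-1 * x)))))).
    apply: is_trig_polyD; first by apply: is_trig_polyM => //; exact: is_trig_poly_cst.
    apply: is_trig_polyM; first exact: is_trig_poly_cst.
    by do 2 apply: is_trig_polyM => //.
  by apply/funext => x /=; rewrite /sign_step; field.
pose half (s : R) := 2^-1 * (s + s * s).
have chalf (u : nat -> R) s : u k @[k --> \oo] --> s -> half (u k) @[k --> \oo] --> half s.
  by move=> us; apply: cvgM; [exact: cvg_cst|apply: cvgD => //; exact: cvgM].
have sin1 (m : nat) (x : R) : `|sin (m.+1%:R^-1 * x)| <= 1.
  by rewrite ler_norml sin_geN1 sin_le1.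
apply: (@factorizes_lim (fun m x => half (Num.sg (sin (m.+1%:R^-1 * x))))) => [m|x].
  apply: (@factorizes_lim (fun k x => half (iter k (@sign_step R) (sin (m.+1%:R^-1 * x))))) => [k|x].
    apply: factorizes_trig_poly => [|x].
      apply: (is_trig_polyM (is_trig_poly_cst _)); apply: is_trig_polyD => //.
      exact: is_trig_polyM.
    have := norm_iter_sign_step_le1 k (sin1 m x); rewrite /half !ler_norml.
    by set t := iter _ _ _ => /andP[t1 t2]; apply/andP; split; nra.
  by apply: chalf; exact: cvg_iter_sign_step.
have -> : (0 < x)%R%:R = half (Num.sg x).
  rewrite /half; have [x0|x0|->] := ltgtP x 0.
  - by rewrite ltr0_sg// mulrNN mulr1 addNr mulr0.
  - by rewrite gtr0_sg// mulr1 mulVf.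
  - by rewrite sgr0 mulr0 addr0 mulr0.
by apply: chalf; exact: cvg_sg_sin_div.
Qed.

Lemma orthant_probE : orthant_prob X =
  \int[N]_y (gauss_avg rho (fun x => (0 < x)%R%:R) y ^+ n).
Proof.
have [_ _ _ <-] := factorizes_pos.
rewrite /orthant_prob.
have mA : measurable [set w | forall i, 0 < X i w].
  rewrite (_ : [set w | _] = \bigcap_(i in [set: 'I_n]) (X i @^-1` `]0, +oo[)).
    apply: fin_bigcap_measurable => // i _; exact: measurable_funPTI.
  by apply/seteqP; split => w /= Xw i; [move=> _|]; have := Xw i;
    rewrite /= in_itv/= andbT => // /(_ I).
rewrite -[in LHS](setIT [set w | _]) -integral_indic// /Rintegral.
congr fine; apply: eq_integral => w _; rewrite indicE; congr _%:E.
have [/set_mem Aw|/negP Aw] := boolP (w \in _).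
  by rewrite big1// => i _; rewrite Aw.
have /existsP[i Xi] : [exists i, ~~ (0 < X i w)].
  apply: contra_notT Aw => /existsPn Xw; apply/mem_set => i.
  by have := Xw i; rewrite negbK.
by rewrite (bigD1 i)//= (negbTE Xi) mul0r.
Qed.

End orthant.

(** * The normal distribution function *)

Definition std_cdf (R : realType) (u : R) : R := fine (normal_prob 0 1 `]-oo, u]).

Section std_cdf.
Context (R : realType).
Implicit Types (x u v : R).
Local Notation mu := (@lebesgue_measure R).
Local Notation N := (normal_prob (0:R) 1).
Local Notation phi := (@std_pdf R).
Local Notation Phi := (@std_cdf R).

Lemma EFin_std_cdf u : ((Phi u)%:E = N `]-oo, u])%E.
Proof. by rewrite fineK// fin_num_measure. Qed.

Lemma std_cdf_Rintegral u : Phi u = \int[mu]_(x in `]-oo, u]) phi x.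
Proof. by rewrite /std_cdf /normal_prob std_pdfE. Qed.

Lemma is_derive_std_cdf u : is_derive u (1 : R) Phi (phi u).
Proof.
have uu : u < u + 1 by rewrite ltrDl.
have i : mu.-integrable `]-oo, u + 1] (EFin \o phi).
  by apply: (integrableS measurableT) => //; exact: integrable_std_pdf.
have [|d1 d2] := @continuous_FTC1 R phi (BInfty R true) u (u + 1) uu i _
  (@continuous_std_pdf R u).
  by rewrite /= ltNyr.
have E : Phi = fun y => \int[mu]_(t in `]-oo, y]) phi t.
  by apply/funext => y; rewrite std_cdf_Rintegral.
rewrite E; split; first exact: d1.
by rewrite -derive1E d2.
Qed.

Lemma derivable_std_cdf u : derivable Phi u (1 : R).
Proof. by have [] := is_derive_std_cdf u. Qed.

Lemma continuous_std_cdf : continuous Phi.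
Proof.
by move=> u; apply/differentiable_continuous/derivable1_diffP/derivable_std_cdf.
Qed.

Lemma std_cdf_ge0 u : 0 <= Phi u.
Proof. by rewrite fine_ge0. Qed.

Lemma std_cdf_le1 u : Phi u <= 1.
Proof. by rewrite -lee_fin EFin_std_cdf probability_le1. Qed.

Lemma std_cdf_MVT u v : u < v -> exists2 c, u < c < v & Phi v - Phi u = phi c * (v - u).
Proof.
move=> uv; have [c] := @MVT R Phi phi u v uv (fun x _ => is_derive_std_cdf x)
  (continuous_subspaceT continuous_std_cdf).
by rewrite in_itv/= => cuv E; exists c.
Qed.

Lemma std_cdf_lt u v : u < v -> Phi u < Phi v.
Proof.
move=> uv; have [c _ E] := std_cdf_MVT uv.
by rewrite -subr_gt0 E mulr_gt0 ?std_pdf_gt0 ?subr_gt0.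
Qed.

Lemma std_cdf_gt0 u : 0 < Phi u.
Proof. by apply: (@le_lt_trans _ _ (Phi (u - 1))); rewrite ?std_cdf_ge0 ?std_cdf_lt// ltrBlDr ltrDl. Qed.

Lemma std_cdf_lt1 u : Phi u < 1.
Proof. by apply: (@lt_le_trans _ _ (Phi (u + 1))); rewrite ?std_cdf_le1 ?std_cdf_lt// ltrDl. Qed.

Lemma cvg_std_cdfy : Phi n%:R @[n --> \oo] --> (1:R).
Proof.
apply: fine_cvg; rewrite -(@probability_setT _ _ R N).
have <- : \bigcup_n `]-oo, n%:R]%classic = [set: R].
  rewrite -subTset => t _/=.
  by exists (Num.truncn t).+1; rewrite //= in_itv/= ltW// truncnS_gt.
apply: nondecreasing_cvg_mu => //; first exact: bigcup_measurable.
move=> n m nm; apply/subsetPset => x/=; rewrite !in_itv/= => /le_trans.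
by apply; rewrite ler_nat.
Qed.

Lemma cvg_std_cdfNy : Phi (- n%:R) @[n --> \oo] --> (0:R).
Proof.
apply: fine_cvg; rewrite (_ : (0:R)%:E = N set0); last by rewrite measure0.
have <- : \bigcap_n `]-oo, - n%:R]%classic = set0 :> set R.
  rewrite -subset0 => t /(_ (Num.truncn (- t)).+1 I).
  by rewrite /= in_itv/= leNgt => /negP; apply; rewrite ltrNl truncnS_gt.
apply: nonincreasing_cvg_mu => //=.
- by rewrite (le_lt_trans (probability_le1 _ _)) ?ltry.
- exact: bigcap_measurable.
- move=> m n mn; apply/subsetPset => x/=; rewrite !in_itv => /le_trans; apply.
  by rewrite lerN2 ler_nat.
Qed.

(** The function Phi(v) + Phi(-v) has derivative zero, as phi is even, and tends to 1. *)
Lemma std_cdfN u : Phi (- u) = 1 - Phi u.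
Proof.
pose F v := Phi v + Phi (- v).
have Fc v w : F v = F w.
  apply: (@is_derive_0_is_cst _ F) => x.
  have := is_derive_std_cdf x => ?; have := is_derive_std_cdf (- x) => ?.
  by apply: is_derive_eq; rewrite std_pdfN /GRing.scale/=; ring.
have F1 : F u = 1.
  have c1 : F n%:R @[n --> \oo] --> (1 : R).
    by rewrite -[X in _ --> X]addr0; apply: cvgD; [exact: cvg_std_cdfy|exact: cvg_std_cdfNy].
  have c2 : F n%:R @[n --> \oo] --> F u.
    by apply: cvg_near_cst; near=> n; exact: Fc.
  exact: (cvg_unique _ c2 c1).
by rewrite -F1 /F; ring.
Unshelve. all: end_near. Qed.

Lemma std_cdf0 : Phi 0 = 1 / 2.
Proof. by have := std_cdfN 0; rewrite oppr0; lra. Qed.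

(** Dividing by sqrt (1 - rho), the event reads z > -t y; symmetry turns its probability into Phi(t
    y). *)
Lemma gauss_avg_pos (rho y : R) : 0 < rho < 1 ->
  gauss_avg rho (fun x => (0 < x)%R%:R) y = Phi (Num.sqrt (rho / (1 - rho)) * y).
Proof.
move=> /andP[rho0 rho1].
have s1 : 0 < Num.sqrt (1 - rho) by rewrite sqrtr_gt0 subr_gt0.
set t := Num.sqrt (rho / (1 - rho)).
have tE : Num.sqrt rho = t * Num.sqrt (1 - rho).
  have r0 : 0 <= rho / (1 - rho) by apply: divr_ge0; lra.
  by rewrite -sqrtrM// divfK// gt_eqF// subr_gt0.
transitivity (\int[N]_z \1_(`]- (t * y), +oo[%classic) z).
  apply: eq_Rintegral => z _; rewrite indicE; congr (nat_of_bool _)%:R.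
  have -> : Num.sqrt rho * y + Num.sqrt (1 - rho) * z =
    (t * y + z) * Num.sqrt (1 - rho) by rewrite tE; ring.
  by rewrite mem_setE in_itv/= andbT pmulr_lgt0// -[in RHS]subr_gt0 opprK addrC.
have -> : Phi (t * y) = 1 - Phi (- (t * y)) by rewrite std_cdfN; lra.
rewrite /Rintegral integral_indic// setIT.
rewrite -[RHS]/(fine (1 - Phi (- (t * y)))%:E); congr fine.
by rewrite -setCitvl EFinB EFin_std_cdf; exact: probability_setC.
Qed.

End std_cdf.

(** * Two-sided estimates of the normal tail *)

Section tail.
Context (R : realType).
Implicit Types (x u v : R).
Local Notation phi := (@std_pdf R).
Local Notation Phi := (@std_cdf R).
Local Notation w u := (expR (- (u ^+ 2 / 2))).

Lemma std_pdf_le u v : 0 <= u -> u <= v -> phi v <= phi u.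
Proof.
move=> u0 uv; rewrite ler_wpM2l ?invr_ge0 ?sqrtr_ge0// ler_expR lerN2.
by rewrite ler_pM2r// ler_sqr// nnegrE (le_trans u0).
Qed.

Lemma std_cdf_average x z : 0 < x -> x <= z ->
  x * (2 * Phi z - 1) <= z * (2 * Phi x - 1).
Proof.
move=> x0; rewrite le_eqVlt => /predU1P[->//|xz].
have [a /andP[a0 ax]] := std_cdf_MVT x0.
have [b /andP[bx bz]] := std_cdf_MVT xz.
rewrite std_cdf0 subr0 => Eb Ea.
have ab : phi b <= phi a by apply: std_pdf_le; [exact: ltW|lra].
have : 0 <= (phi a - phi b) * (x * (z - x)).
  by rewrite mulr_ge0 ?subr_ge0// mulr_ge0// ?subr_ge0 ltW.
have -> : Phi z = 1 / 2 + phi a * x + phi b * (z - x) by lra.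
have -> : Phi x = 1 / 2 + phi a * x by lra.
lra.
Qed.

(** Chosen so that kappa w = 4 phi, which gives D' = w h. *)
Let kappa : R := 4 * (Num.sqrt (2 * pi))^-1.
Let D u := w u - 4 * (Phi u * (1 - Phi u)).
Let h u := kappa * (2 * Phi u - 1) - u.

Let kappa0 : 0 < kappa.
Proof. by rewrite mulr_gt0// invr_gt0 sqrtr_gt0 mulr_gt0 ?pi_gt0. Qed.

Let is_derive_D u : is_derive u (1:R) D (w u * h u).
Proof.
have := is_derive_std_cdf u => ?.
apply: is_derive_eq; rewrite /h /kappa /std_pdf /GRing.scale/=.
by set k := (Num.sqrt _)^-1; field.
Qed.

Let D_MVT u v : u < v -> exists2 c, u < c < v & D v - D u = w c * h c * (v - u).
Proof.
move=> uv; have [||c] := @MVT R D (fun c => w c * h c) u v uv.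
- by move=> x _; exact: is_derive_D.
- apply: continuous_subspaceT => x; apply/differentiable_continuous/derivable1_diffP.
  by have [] := is_derive_D x.
- by rewrite in_itv/= => cuv E; exists c.
Qed.

(* The sign of D' is that of h, whose ratio to u decreases on u > 0; thus D
   increases from D 0 = 0 and then decreases to its limit 0. *)
Let D_ge0 u : 0 < u -> 0 <= D u.
Proof.
move=> u0; have [hu|hu] := leP 0 (h u).
  have [c /andP[c0 cu]] := D_MVT u0.
  rewrite subr0 {2}/D std_cdf0 expr0n mul0r oppr0 expR0 => E.
  have hc : 0 <= h c.
    have := std_cdf_average c0 (ltW cu); move: hu; rewrite /h.
    set A := 2 * Phi u - 1; set B := 2 * Phi c - 1 => hu cA.
    rewrite -(pmulr_rge0 _ u0).
    have : kappa * (c * A) <= kappa * (u * B) by rewrite ler_pM2l.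
    have : 0 <= c * (kappa * A - u) by rewrite mulr_ge0// ltW.
    by lra.
  have : 0 <= w c * h c * u by rewrite !mulr_ge0 ?expR_ge0// ltW.
  by rewrite -E; lra.
have Dle z : u < z -> D z <= D u.
  move=> uz; have [c /andP[uc cz] E] := D_MVT uz.
  have hc : h c <= 0.
    have := std_cdf_average u0 (ltW uc); move: hu; rewrite /h.
    set A := 2 * Phi u - 1; set B := 2 * Phi c - 1 => hu cA.
    rewrite -(pmulr_rle0 _ u0).
    have : kappa * (u * B) <= kappa * (c * A) by rewrite ler_pM2l.
    have : 0 <= c * (u - kappa * A) by rewrite mulr_ge0; lra.
    by lra.
  rewrite -subr_le0 E; have := expR_gt0 (- (c ^+ 2 / 2)).
  by rewrite -mulrA => w0; rewrite pmulr_rle0// mulr_le0_ge0// subr_ge0 ltW.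
have Dlim : D n%:R @[n --> \oo] --> (0 : R).
  rewrite -[X in _ --> X](subr0 0); apply: cvgB.
    have -> : (0 : R) = (Num.sqrt (2 * pi)) * 0 by rewrite mulr0.
    have s0 : Num.sqrt (2 * pi) != 0 :> R by rewrite gt_eqF// sqrtr_gt0 mulr_gt0 ?pi_gt0.
    under eq_fun => n do rewrite -[w _](mulVKf s0) -/(phi n%:R).
    apply: cvgM; first exact: cvg_cst.
    have := @cvg_mul_std_pdf R (cst 1) 1 (fun n => n%:R) _ (fun n => normr_nat _ _).
    under eq_fun do rewrite mul1r; apply.
    by move=> x; rewrite normr1 mul1r lerDl.
  have -> : (0 : R) = 4 * (1 * (1 - 1)) by rewrite subrr !mulr0.
  apply: cvgM; first exact: cvg_cst.
  apply: cvgM; first exact: cvg_std_cdfy.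
  by apply: cvgB; [exact: cvg_cst|exact: cvg_std_cdfy].
rewrite -(cvg_lim _ Dlim)//; apply: limr_le; first by apply: cvgP Dlim.
near=> n; apply: Dle; near: n; exact: nbhs_infty_gtr.
Unshelve. all: end_near. Qed.

(** Both sides are even in [u], which leaves u > 0; at u = 0 there is equality. *)
Lemma std_cdf_tail_le u : 4 * (Phi u * (1 - Phi u)) <= w u.
Proof.
have [u0|u0|->] := ltgtP u 0.
- rewrite -[u]opprK std_cdfN sqrrN -subr_ge0.
  have := @D_ge0 (- u); rewrite oppr_gt0 => /(_ u0); rewrite /D sqrrN.
  by lra.
- by rewrite -subr_ge0; exact: D_ge0.
- by rewrite std_cdf0 expr0n mul0r oppr0 expR0; lra.
Qed.

(** Only the mass of [u, u + d] with d = 1 / (1 + u) is kept. There phi is at least phi(u) exp(-u d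
    - d^2/2), and u d <= 1, d <= 1 bound the loss by exp(-3/2). *)
Lemma std_cdf_tail_ge u : 0 <= u ->
  phi u * (expR (- (3 / 2)) / (1 + u)) <= 1 - Phi u.
Proof.
move=> u0; set d := (1 + u)^-1.
have d0 : 0 < d by rewrite invr_gt0; lra.
have ud : u < u + d by rewrite ltrDl.
have [c /andP[uc cud] E] := std_cdf_MVT ud.
apply: (@le_trans _ _ (Phi (u + d) - Phi u)); last by rewrite lerB// std_cdf_le1.
rewrite E addrAC subrr add0r mulrA ler_pM2r//.
apply: (@le_trans _ _ (phi (u + d))); last first.
  by apply: std_pdf_le; [exact: le_trans (ltW uc)|exact: ltW].
rewrite /std_pdf -mulrA ler_wpM2l ?invr_ge0 ?sqrtr_ge0// -expRD ler_expR.
have d1 : d <= 1 by rewrite invf_le1; lra.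
have ud1 : u * d <= 1 by rewrite ler_pdivrMr; lra.
nra.
Qed.

End tail.

(** * Comparison with the gamma integral *)

Section substitution.
Context (R : realType).
Local Notation mu := (@lebesgue_measure R).
Local Notation phi := (@std_pdf R).
Local Notation Phi := (@std_cdf R).

(** For [u] standard normal, Phi(u) is uniform on ]0, 1[ and this is a standard exponential
    variable; hence the gamma integrals. *)
Definition neg_ln_cdf (u : R) : R := - ln (Phi u).
Local Notation Y := neg_ln_cdf.

Lemma neg_ln_cdf_gt0 u : 0 < Y u.
Proof. by rewrite oppr_gt0 ln_lt0// std_cdf_gt0 std_cdf_lt1. Qed.

Lemma expR_neg_ln_cdf u : expR (- Y u) = Phi u.
Proof. by rewrite opprK lnK// posrE std_cdf_gt0. Qed.

Lemma is_derive_neg_ln_cdf u : is_derive u (1 : R) Y (- (phi u / Phi u)).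
Proof.
have := is_derive_std_cdf u => ?; have := is_derive1_ln (std_cdf_gt0 u) => ?.
by apply: is_derive_eq; rewrite /GRing.scale/= mulrC.
Qed.

Lemma continuous_neg_ln_cdf : continuous Y.
Proof.
move=> u; apply/differentiable_continuous/derivable1_diffP.
by have [] := is_derive_neg_ln_cdf u.
Qed.

Lemma neg_ln_cdf_lt u v : u < v -> Y v < Y u.
Proof.
by move=> uv; rewrite ltrN2 ltr_ln ?posrE ?std_cdf_gt0// std_cdf_lt.
Qed.

Definition gamma_integrand (b t : R) : R := t `^ (b - 1) * expR (- t).

Lemma gamma_integrand_ge0 b t : 0 <= gamma_integrand b t.
Proof. by rewrite mulr_ge0 ?powR_ge0 ?expR_ge0. Qed.

Lemma measurable_gamma_integrand b : measurable_fun setT (gamma_integrand b).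
Proof.
apply: measurable_funM; first exact: measurable_powR.
by apply: measurableT_comp => //; exact: measurable_oppr.
Qed.

Lemma continuous_gamma_integrand b t : 0 < t -> {for t, continuous (gamma_integrand b)}.
Proof.
move=> t0; apply/differentiable_continuous/derivable1_diffP.
have := is_derive1_powR (b - 1) t0 => ?.
by rewrite /gamma_integrand; apply: ex_derive.
Qed.

(* The substitution is t = - c * ln (Phi u). *)
Lemma gamma_integral_subst (b c : R) : 0 < c ->
  (\int[mu]_(t in `]0%R, +oo[) (gamma_integrand b t)%:E =
   \int[mu]_u (c `^ b * (Y u `^ (b - 1) * expR (- ((c - 1) * Y u)) * phi u))%:E)%E.
Proof.
move=> c0; pose F u := c * Y u.
have dF u : is_derive u (1:R) F (- (c * (phi u / Phi u))).
  have := is_derive_neg_ln_cdf u => ?.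
  by apply: is_derive_eq; rewrite /GRing.scale/=; ring.
have F'E : F^`()%classic = fun u => - (c * (phi u / Phi u)).
  by apply/funext => u; rewrite derive1E; have [_] := dF u.
have cF' : continuous F^`()%classic.
  move=> u; rewrite F'E; apply: cvgN; apply: cvgM; first exact: cvg_cst.
  apply: cvgM; first exact: continuous_std_pdf.
  by apply: cvgV; [rewrite gt_eqF// std_cdf_gt0|exact: continuous_std_cdf].
have cF : continuous F.
  by move=> u; apply: cvgM; [exact: cvg_cst|exact: continuous_neg_ln_cdf].
have F0 u : 0 < F u by rewrite mulr_gt0// neg_ln_cdf_gt0.
have Flt u v : u < v -> F v < F u by move=> uv; rewrite ltr_pM2l// neg_ln_cdf_lt.
(* The substitution is made on [-n, n]; [F] decreases, so the ends of the image [B n] are exchanged.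
   Monotone convergence then gives the whole line. *)
pose A (n : nat) : set R := `[- n%:R, n%:R]%classic.
pose B (n : nat) : set R := `[F n%:R, F (- n%:R)]%classic.
pose H u := c `^ b * (Y u `^ (b - 1) * expR (- ((c - 1) * Y u)) * phi u).
have H0 u : 0 <= H u by rewrite !mulr_ge0 ?powR_ge0 ?expR_ge0 ?std_pdf_ge0.
have mH : measurable_fun setT H.
  apply: measurable_funM => //; apply: measurable_funM; last exact: measurable_std_pdf.
  have mY : measurable_fun setT Y by apply: continuous_measurable_fun; exact: continuous_neg_ln_cdf.
  apply: measurable_funM; first exact: (measurableT_comp (measurable_powR _)).
  apply: measurableT_comp => //; apply: measurableT_comp => //.
  exact: measurable_funM.
have step n : (\int[mu]_(t in B n) (gamma_integrand b t)%:E =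
    \int[mu]_(u in A n) (H u)%:E)%E.
  have nn : - n%:R <= n%:R :> R by rewrite lerNl (@le_trans _ _ 0)// oppr_le0.
  rewrite (@integration_by_substitution_decreasing R F)//.
  - apply: eq_integral => u _ /=; rewrite F'E opprK; congr _%:E.
    rewrite -[LHS]/(gamma_integrand b (F u) * (c * (phi u / Phi u))) /H.
    rewrite /gamma_integrand /F powRM ?ltW ?neg_ln_cdf_gt0//.
    have -> : c `^ b = c * c `^ (b - 1).
      have cn0 : c != 0 by rewrite gt_eqF.
      rewrite -[X in X * _](powRr1 (ltW c0)) -powRD ?cn0 ?implybT//.
      by congr (_ `^ _); ring.
    (* The denominator Phi of the derivative of [F] lowers the exponent from c to c - 1. *)
    have -> : expR (- ((c - 1) * Y u)) = expR (- (c * Y u)) / Phi u.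
      by rewrite -expR_neg_ln_cdf -expRN opprK -expRD; congr expR; ring.
    by field; rewrite gt_eqF// std_cdf_gt0.
  - by move=> x y _ _; exact: Flt.
  - by apply: cvgP; apply: cvg_at_right_filter; exact: cF'.
  - by apply: cvgP; apply: cvg_at_left_filter; exact: cF'.
  - split; first by move=> x _; have [] := dF x.
      by apply: cvg_at_right_filter; exact: cF.
    by apply: cvg_at_left_filter; exact: cF.
  - apply: continuous_in_subspaceT => t; rewrite inE/= in_itv/= => /andP[tn _].
    by apply: continuous_gamma_integrand; exact: lt_le_trans (F0 _) tn.
have UA : \bigcup_n A n = setT.
  rewrite -subTset => t _; exists (Num.truncn `|t|).+1 => //.
  by rewrite /A/= in_itv/= -ler_norml ltW// truncnS_gt.
have UB : \bigcup_n B n = `]0, +oo[%classic.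
  apply/seteqP; split => [t [n _]|t].
    by rewrite /B/= !in_itv/= andbT => /andP[a1 _]; exact: lt_le_trans a1.
  rewrite /= in_itv/= andbT => t0.
  have e1 : expR (- (t / c)) < 1 by rewrite expR_lt1 oppr_lt0 divr_gt0.
  have Fle u s : (F u <= s) = (expR (- (s / c)) <= Phi u).
    by rewrite -expR_neg_ln_cdf ler_expR lerN2 ler_pdivlMr// mulrC.
  have Fge u s : (s <= F u) = (Phi u <= expR (- (s / c))).
    by rewrite -expR_neg_ln_cdf ler_expR lerN2 ler_pdivrMr// mulrC.
  near \oo => n; exists n => //; rewrite /B/= in_itv/= Fle Fge; apply/andP; split.
    by near: n; apply: cvgr_ge e1; exact: cvg_std_cdfy.
  by near: n; move/cvgr_le: (@cvg_std_cdfNy R); apply; exact: expR_gt0.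
have ndA : nondecreasing_seq A.
  move=> n m nm; apply/subsetPset => x; rewrite /A/= !in_itv/= -!ler_norml => /le_trans.
  by apply; rewrite ler_nat.
have Fle u v : u <= v -> F v <= F u.
  by rewrite le_eqVlt => /predU1P[->//|/Flt/ltW].
have ndB : nondecreasing_seq B.
  move=> n m nm; apply/subsetPset => x; rewrite /B/= !in_itv/= => /andP[a1 a2].
  apply/andP; split.
    by apply: le_trans a1; apply: Fle; rewrite ler_nat.
  by apply: le_trans a2 _; apply: Fle; rewrite lerN2 ler_nat.
have cA := ge0_nondecreasing_set_cvg_integral (T := measurableTypeR R) (mu := mu)
  (F := A) (f := EFin \o H) ndA
  (fun n => measurable_itv _)
  (fun n => (measurable_EFinP _ _).2 (measurable_funTS mH))
  (fun n x _ => H0 x).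
have cB := ge0_nondecreasing_set_cvg_integral (T := measurableTypeR R) (mu := mu)
  (F := B) (f := EFin \o gamma_integrand b) ndB
  (fun n => measurable_itv _)
  (fun n => (measurable_EFinP _ _).2 (measurable_funTS (measurable_gamma_integrand b)))
  (fun n x _ => gamma_integrand_ge0 b x).
rewrite UA in cA; rewrite UB in cB.
have E : (fun n => \int[mu]_(t in B n) (gamma_integrand b t)%:E)%E =
    (fun n => \int[mu]_(u in A n) (H u)%:E)%E by apply/funext.
rewrite E in cB; exact: (cvg_unique _ cB cA).
Unshelve. all: end_near. Qed.

End substitution.

(** * The orthant integral and its comparison with the gamma integral *)

Section gauss_weight.
Context (R : realType).
Local Notation mu := (@lebesgue_measure R).
Local Notation phi := (@std_pdf R).
Local Notation Phi := (@std_cdf R).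
Local Notation Y := (@neg_ln_cdf R).
Local Notation N := (normal_prob (0:R) 1).

Definition gauss_weight (u : R) : R := expR (- (u ^+ 2 / 2)).
Local Notation w := gauss_weight.

Lemma gauss_weight_gt0 u : 0 < w u. Proof. exact: expR_gt0. Qed.

Lemma gauss_weight_le1 u : w u <= 1.
Proof. by rewrite expR_le1 oppr_le0 mulr_ge0 ?sqr_ge0. Qed.

(** This is 1 + Y <= exp Y multiplied by Phi = exp(-Y). *)
Lemma neg_ln_cdf_le_tail u : Phi u * Y u <= 1 - Phi u.
Proof.
have E : expR (Y u) = (Phi u)^-1 by rewrite -expR_neg_ln_cdf expRN invrK.
have := expR_ge1Dx (Y u); rewrite E.
rewrite -(ler_pM2l (std_cdf_gt0 u)) mulfV ?gt_eqF ?std_cdf_gt0//.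
by lra.
Qed.

Lemma gauss_weight_ge u : 4 * (Y u * Phi u ^+ 2) <= w u.
Proof.
apply: le_trans (std_cdf_tail_le u); rewrite ler_pM2l//.
rewrite expr2 mulrCA ler_pM2l ?std_cdf_gt0// mulrC.
exact: neg_ln_cdf_le_tail.
Qed.

(** Extended-real values let comparisons precede finiteness: that of the gamma integral for b >= 1
    is itself deduced from one. *)
Definition orthant_integral (n : nat) (b : R) : \bar R :=
  (\int[mu]_u (Phi u ^+ n * w u `^ (b - 1) * phi u)%:E)%E.

Lemma measurable_std_cdf : measurable_fun setT Phi.
Proof. by apply: continuous_measurable_fun; exact: continuous_std_cdf. Qed.

Lemma measurable_neg_ln_cdf : measurable_fun setT Y.
Proof. by apply: continuous_measurable_fun; exact: continuous_neg_ln_cdf. Qed.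

Lemma measurable_gauss_weight : measurable_fun setT w.
Proof.
apply: measurableT_comp => //; apply: measurableT_comp => //.
by apply: measurable_funM => //; exact: measurable_funX.
Qed.

(** Put y = al u, where al is the inverse of t = sqrt (rho / (1 - rho)): this turns Phi(t y) into
    Phi(u), and al^2 = b gives phi(al u) = w(u)^(b-1) phi(u). *)
Lemma orthant_probE_integral d (T : measurableType d) (P : probability T R)
    (n : nat) (rho : R) (X : 'I_n -> {RV P >-> R}) : 0 < rho < 1 ->
  equicorrelated_normal rho X ->
  ((orthant_prob X)%:E =
   (Num.sqrt ((1 - rho) / rho))%:E * orthant_integral n (1 / rho - 1))%E.
Proof.
move=> rho01 hX; have [rho0 rho1] := andP rho01.
rewrite (orthant_probE rho01 hX).
set t := Num.sqrt (rho / (1 - rho)); set al := Num.sqrt ((1 - rho) / rho).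
have al0 : 0 < al by rewrite sqrtr_gt0 divr_gt0 ?subr_gt0.
have rn0 : rho != 0 by rewrite gt_eqF.
have rn1 : 1 - rho != 0 by rewrite gt_eqF ?subr_gt0.
have tal : t * al = 1.
  rewrite -sqrtrM; last by apply: divr_ge0; lra.
  have -> : rho / (1 - rho) * ((1 - rho) / rho) = 1 by field; rewrite rn0 rn1.
  exact: sqrtr1.
have al2 : al ^+ 2 = 1 / rho - 1.
  rewrite sqr_sqrtr; last by apply: divr_ge0; lra.
  by field; rewrite ?rn0 ?rn1.
have bPhi : bounded_measurable (fun y => Phi (t * y) ^+ n).
  split.
    apply: measurable_funX; apply: (measurableT_comp measurable_std_cdf).
    exact: measurable_funM.
  exists 1 => y; rewrite ger0_norm ?exprn_ge0 ?std_cdf_ge0//.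
  by rewrite exprn_ile1 ?std_cdf_ge0 ?std_cdf_le1.
under eq_Rintegral do rewrite gauss_avg_pos//.
rewrite (std_normal_Rintegral bPhi) /Rintegral fineK; last first.
  apply: integrable_fin_num => //; have [mf [M fM]] := bPhi.
  apply: (integrable_std_pdfM (c := M)) => // x.
  rewrite (le_trans (fM x))// ler_peMr ?ge1_expRsqr4//.
  exact: le_trans (fM 0).
rewrite (@ge0_integral_affine R 0 al)//; last 2 first.
- move=> y; apply: cvgM; last exact: continuous_std_pdf.
  apply: (cvg_comp (fun y => Phi (t * y)) (fun x => x ^+ n)).
    apply: (cvg_comp (fun y => t * y) Phi).
      by apply: cvgM; [exact: cvg_cst|exact: cvg_id].
    exact: continuous_std_cdf.
  exact: exprn_continuous.
- by move=> y; rewrite mulr_ge0 ?exprn_ge0 ?std_cdf_ge0 ?std_pdf_ge0.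
rewrite /orthant_integral -ge0_integralZl//; last 3 first.
- apply/measurable_EFinP; apply: measurable_funM; last exact: measurable_std_pdf.
  apply: measurable_funM; first by apply: measurable_funX; exact: measurable_std_cdf.
  by apply: (measurableT_comp (measurable_powR _)); exact: measurable_gauss_weight.
- by move=> u _; rewrite lee_fin !mulr_ge0 ?exprn_ge0 ?std_cdf_ge0 ?powR_ge0 ?std_pdf_ge0.
- by rewrite lee_fin ltW.
apply: eq_integral => u _; rewrite -EFinM; congr _%:E.
rewrite add0r [t * _]mulrA tal mul1r.
have -> : phi (al * u) = w u `^ (1 / rho - 1 - 1) * phi u.
  rewrite /w -expRM /std_pdf mulrCA -expRD; congr (_ * expR _).
  by rewrite exprMn al2; field; rewrite ?rn0 ?rn1.
by ring.
Qed.

Definition gamma_integral (b : R) : \bar R :=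
  (\int[mu]_(t in `]0%R, +oo[) (gamma_integrand b t)%:E)%E.

(** Replacing w by 4 Y Phi^2 produces Phi^(n + 2(b-1)), which is Phi^(c-1) for c = n + 2b - 1. *)
Let weight_pow (n : nat) (b u : R) :
  4 `^ (b - 1) * (Y u `^ (b - 1) * expR (- ((n%:R + 2 * b - 1 - 1) * Y u)) * phi u) =
  Phi u ^+ n * (4 * (Y u * Phi u ^+ 2)) `^ (b - 1) * phi u.
Proof.
rewrite powRM ?mulr_ge0 ?exprn_ge0 ?std_cdf_ge0 ?ltW ?neg_ln_cdf_gt0//.
rewrite powRM ?exprn_ge0 ?std_cdf_ge0 ?ltW ?neg_ln_cdf_gt0//.
rewrite -expR_neg_ln_cdf -!expRM_natl -expRM.
have -> : - ((n%:R + 2 * b - 1 - 1) * Y u) = n%:R * - Y u + 2 * - Y u * (b - 1) by ring.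
by rewrite expRD; ring.
Qed.

Lemma measurable_gamma_part (b c k : R) :
  measurable_fun setT (fun u => (k * (Y u `^ (b - 1) * expR (- (c * Y u)) * phi u))%:E).
Proof.
apply/measurable_EFinP; apply: measurable_funM => //.
apply: measurable_funM; last exact: measurable_std_pdf.
apply: measurable_funM.
  by apply: (measurableT_comp (measurable_powR _)); exact: measurable_neg_ln_cdf.
apply: measurableT_comp => //; apply: measurableT_comp => //.
by apply: measurable_funM => //; exact: measurable_neg_ln_cdf.
Qed.

Lemma measurable_orthant_part (n : nat) (b : R) :
  measurable_fun setT (fun u => (Phi u ^+ n * w u `^ (b - 1) * phi u)%:E).
Proof.
apply/measurable_EFinP; apply: measurable_funM; last exact: measurable_std_pdf.
apply: measurable_funM; first by apply: measurable_funX; exact: measurable_std_cdf.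
by apply: (measurableT_comp (measurable_powR _)); exact: measurable_gauss_weight.
Qed.

Lemma gamma_part (b c : R) : 0 < c ->
  ((c `^ (- b))%:E * gamma_integral b =
   \int[mu]_u (Y u `^ (b - 1) * expR (- ((c - 1) * Y u)) * phi u)%:E)%E.
Proof.
move=> c0; rewrite /gamma_integral (gamma_integral_subst b c0).
under eq_integral do rewrite EFinM.
rewrite ge0_integralZl//; last 3 first.
- have := @measurable_gamma_part b (c - 1) 1.
  by under eq_fun do rewrite mul1r.
- by move=> u _; rewrite lee_fin !mulr_ge0 ?powR_ge0 ?expR_ge0 ?std_pdf_ge0.
- by rewrite lee_fin powR_ge0.
have cn0 : c != 0 by rewrite gt_eqF.
by rewrite muleA -EFinM -powRD ?cn0 ?implybT// addNr powRr0 mul1e.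
Qed.

Lemma gamma_le_orthant_integral (n : nat) (b : R) : 1 <= b ->
  ((4 `^ (b - 1))%:E * ((n%:R + 2 * b - 1) `^ (- b))%:E * gamma_integral b <=
   orthant_integral n b)%E.
Proof.
move=> b1; rewrite -muleA (@gamma_part b (n%:R + 2 * b - 1)); last first.
  by have := ler0n R n; lra.
rewrite -ge0_integralZl//; last 2 first.
- have := @measurable_gamma_part b (n%:R + 2 * b - 1 - 1) 1.
  by under eq_fun do rewrite mul1r.
- by move=> u _; rewrite lee_fin !mulr_ge0 ?powR_ge0 ?expR_ge0 ?std_pdf_ge0.
apply: ge0_le_integral => //.
- by move=> u _; rewrite -EFinM lee_fin !mulr_ge0 ?powR_ge0 ?expR_ge0 ?std_pdf_ge0.
- by under eq_fun do rewrite -EFinM; exact: measurable_gamma_part.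
- exact: measurable_orthant_part.
move=> u _; rewrite -EFinM lee_fin weight_pow.
rewrite ler_pM2r ?std_pdf_gt0// ler_pM2l ?exprn_gt0 ?std_cdf_gt0//.
have v0 : 0 < 4 * (Y u * Phi u ^+ 2).
  by rewrite !mulr_gt0 ?neg_ln_cdf_gt0 ?exprn_gt0 ?std_cdf_gt0.
apply: ge0_ler_powR;
  [by rewrite subr_ge0|by rewrite nnegrE ltW|by rewrite nnegrE ltW ?gauss_weight_gt0|exact: gauss_weight_ge].
Qed.

Lemma orthant_integral_le_gamma (n : nat) (b : R) : (0 < n)%N -> 0 < b <= 1 ->
  (orthant_integral n b <=
   (4 `^ (b - 1))%:E * ((n%:R + 2 * b - 1) `^ (- b))%:E * gamma_integral b)%E.
Proof.
move=> n0 /andP[b0 b1]; rewrite -muleA (@gamma_part b (n%:R + 2 * b - 1)); last first.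
  (* Here n >= 1 keeps c = n + 2b - 1 positive even for [b] close to 0. *)
  by have : 1 <= n%:R :> R; [rewrite ler1n|lra].
rewrite -ge0_integralZl//; last 2 first.
- have := @measurable_gamma_part b (n%:R + 2 * b - 1 - 1) 1.
  by under eq_fun do rewrite mul1r.
- by move=> u _; rewrite lee_fin !mulr_ge0 ?powR_ge0 ?expR_ge0 ?std_pdf_ge0.
apply: ge0_le_integral => //.
- by move=> u _; rewrite lee_fin !mulr_ge0 ?exprn_ge0 ?std_cdf_ge0 ?powR_ge0 ?std_pdf_ge0.
- exact: measurable_orthant_part.
- by under eq_fun do rewrite -EFinM; exact: measurable_gamma_part.
move=> u _; rewrite -EFinM lee_fin weight_pow.
rewrite ler_pM2r ?std_pdf_gt0// ler_pM2l ?exprn_gt0 ?std_cdf_gt0//.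
have v0 : 0 < 4 * (Y u * Phi u ^+ 2).
  by rewrite !mulr_gt0 ?neg_ln_cdf_gt0 ?exprn_gt0 ?std_cdf_gt0.
rewrite -[b - 1]opprB !powRN lef_pV2 ?posrE ?powR_gt0 ?gauss_weight_gt0//.
apply: ge0_ler_powR;
  [by rewrite subr_ge0|by rewrite nnegrE ltW|by rewrite nnegrE ltW ?gauss_weight_gt0|exact: gauss_weight_ge].
Qed.

(** The comparison with n = 0 suffices: the orthant integral is then at most the total mass of phi,
    because w <= 1. *)
Lemma gamma_integral_lty (b : R) : 1 <= b -> (gamma_integral b < +oo)%E.
Proof.
move=> b1; have := gamma_le_orthant_integral 0 b1.
have : (orthant_integral 0 b <= 1)%E.
  rewrite -(integral_std_pdf R); apply: ge0_le_integral => //.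
  - by move=> u _; rewrite lee_fin !mulr_ge0 ?exprn_ge0 ?std_cdf_ge0 ?powR_ge0 ?std_pdf_ge0.
  - exact: measurable_orthant_part.
  - by apply/measurable_EFinP; exact: measurable_std_pdf.
  move=> u _; rewrite lee_fin expr0 mul1r ler_piMl ?std_pdf_ge0//.
  apply: (@le_trans _ _ (1 `^ (b - 1))); last by rewrite powR1.
  apply: ge0_ler_powR; rewrite ?nnegrE ?subr_ge0 ?gauss_weight_le1//.
  by apply: ltW; exact: gauss_weight_gt0.
case: (gamma_integral b) => [r||] //; first by rewrite ltry.
rewrite -EFinM gt0_muley; last first.
  by rewrite lte_fin mulr_gt0 ?powR_gt0//; lra.
by move=> h1 /le_trans /(_ h1).
Qed.

End gauss_weight.

(** * Upper bounds for gamma integrals, and the beta integral *)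

Section gamma_beta_bounds.
Context (R : realType).
Local Notation mu := (@lebesgue_measure R).

Lemma integral_quadratic_expRN (p0 p1 p2 a : R) :
  0 <= p0 -> 0 <= p1 -> 0 <= p2 -> 0 <= a ->
  (\int[mu]_(t in `[a, +oo[) ((p0 + p1 * t + p2 * t ^+ 2) * expR (- t))%:E =
   ((p0 + p1 + 2 * p2 + (p1 + 2 * p2) * a + p2 * a ^+ 2) * expR (- a))%:E)%E.
Proof.
move=> p00 p10 p20 a0.
pose A := p0 + p1 + 2 * p2; pose B := p1 + 2 * p2.
pose F (t : R) := - ((A + B * t + p2 * t ^+ 2) * expR (- t)).
have dF (t : R) : is_derive t (1:R) F ((p0 + p1 * t + p2 * t ^+ 2) * expR (- t)).
  rewrite /F; apply: is_derive_eq; rewrite /A /B /GRing.scale/=; ring.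
have cF : continuous F.
  by move=> t; apply/differentiable_continuous/derivable1_diffP; have [] := dF t.
have A0 : 0 <= A by rewrite /A; lra.
have B0 : 0 <= B by rewrite /B; lra.
rewrite (@ge0_continuous_FTC2y R _ F a 0).
- by rewrite -EFinB /F sub0r opprK.
- move=> t at0; have t0 : 0 <= t by exact: le_trans at0.
  by rewrite mulr_ge0 ?expR_ge0// !addr_ge0// mulr_ge0// sqr_ge0.
- apply: continuous_subspaceT => t; apply/differentiable_continuous/derivable1_diffP.
  have : is_derive t (1:R) (fun t : R => (p0 + p1 * t + p2 * t ^+ 2) * expR (- t))
    ((p1 + 2 * p2 * t - (p0 + p1 * t + p2 * t ^+ 2)) * expR (- t)).
    by apply: is_derive_eq; rewrite /GRing.scale/=; ring.
  by case.
(* For t >= 1 the polynomial is at most (A + B + p2) t^2, and exp t >= t^3 / 6. *)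
- have cK : 6 * (A + B + p2) / t @[t --> +oo] --> (0 : R).
    rewrite -(mulr0 (6 * (A + B + p2))); apply: cvgM; first exact: cvg_cst.
    rewrite gtr0_cvgV0; first exact: cvg_id.
    by near=> t; near: t; exact: nbhs_pinfty_gt.
  apply: (@squeeze_cvgr _ _ _ _ (fun t => - (6 * (A + B + p2) / t)) (cst 0)).
  + near=> t; have t1 : 1 <= t by near: t; exact: nbhs_pinfty_ge.
    have t0 : 0 < t by lra.
    have q0 : 0 <= A + B * t + p2 * t ^+ 2.
      by rewrite !addr_ge0// mulr_ge0 ?sqr_ge0// ltW.
    rewrite /F/= oppr_le0 mulr_ge0 ?expR_ge0// andbT.
    rewrite lerN2 expRN ler_pdivrMr ?expR_gt0//.
    have e3 := expR_ge1Dxn 2 (ltW t0).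
    have e4 : t ^+ 3 / 6 <= expR t by move: e3; rewrite (_ : 3`!%N = 6%N)//; lra.
    apply: (@le_trans _ _ ((A + B + p2) * t ^+ 2)).
      have h1 : 0 <= A * (t ^+ 2 - 1) by rewrite mulr_ge0// subr_ge0 exprn_ege1.
      have h2 : 0 <= B * (t * (t - 1)) by rewrite !mulr_ge0 ?subr_ge0// ltW.
      lra.
    have -> : (A + B + p2) * t ^+ 2 = 6 * (A + B + p2) / t * (t ^+ 3 / 6).
      by field; rewrite gt_eqF.
    have K0 : 0 <= 6 * (A + B + p2) / t.
      have S0 := addr_ge0 (addr_ge0 A0 B0) p20.
      by apply: divr_ge0; [apply: mulr_ge0|exact: ltW].
    exact: ler_wpM2l.
  + by rewrite -oppr0; apply: cvgN.
  + exact: cvg_cst.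
- by move=> t _; have [] := dF t.
- by apply: cvg_at_right_filter; exact: cF.
- by move=> t _; rewrite derive1E; have [_] := dF t.
Unshelve. all: end_near. Qed.

(** The weighted arithmetic-geometric mean inequality for 1 and t. Both are written as t^th times an
    exponential; after exp x >= 1 + x the linear terms cancel. *)
Lemma powR_le_affine (th t : R) : 0 <= th <= 1 -> 0 < t ->
  t `^ th <= (1 - th) + th * t.
Proof.
move=> /andP[th0 th1] t0; pose x := ln t.
have tE : t = expR x by rewrite lnK.
rewrite tE -expRM mulrC.
have e1 := expR_ge1Dx ((1 - th) * x); have e2 := expR_ge1Dx (- (th * x)).
have p := expR_gt0 (th * x).
have E1 : expR x = expR (th * x) * expR ((1 - th) * x) by rewrite -expRD; congr expR; ring.
have E2 : 1 = expR (th * x) * expR (- (th * x)) by rewrite -expRD subrr expR0.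
have h1 : 0 <= th * (expR (th * x) * (expR ((1 - th) * x) - (1 + (1 - th) * x))).
  by rewrite mulr_ge0// mulr_ge0 ?subr_ge0// ltW.
have h2 : 0 <= (1 - th) * (expR (th * x) * (expR (- (th * x)) - (1 + - (th * x)))).
  by rewrite mulr_ge0 ?subr_ge0// mulr_ge0 ?subr_ge0// ltW.
have -> : 1 - th = (1 - th) * (expR (th * x) * expR (- (th * x))) by rewrite -E2 mulr1.
rewrite E1; lra.
Qed.

Lemma measurable_quadratic_expRN (p0 p1 p2 : R) : measurable_fun setT
  (fun t : R => ((p0 + p1 * t + p2 * t ^+ 2) * expR (- t))%:E).
Proof.
apply/measurable_EFinP; apply: measurable_funM.
  apply: measurable_funD; first exact: measurable_funD.
  by apply: measurable_funM => //; exact: measurable_funX.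
by apply: measurableT_comp => //; exact: measurable_oppr.
Qed.

(** The bound is p0 Gamma(1) + p1 Gamma(2) + p2 Gamma(3). *)
Lemma gamma_integral_le_quadratic (b p0 p1 p2 : R) :
  0 <= p0 -> 0 <= p1 -> 0 <= p2 ->
  (forall t, 0 < t -> t `^ (b - 1) <= p0 + p1 * t + p2 * t ^+ 2) ->
  (gamma_integral b <= (p0 + p1 + 2 * p2)%:E)%E.
Proof.
move=> p00 p10 p20 tb.
have mq := measurable_quadratic_expRN p0 p1 p2.
have := integral_quadratic_expRN p00 p10 p20 (lexx 0).
rewrite expr0n !mulr0 !addr0 oppr0 expR0 mulr1 => <-.
apply: (@le_trans _ _ (\int[mu]_(t in `]0%R, +oo[)
    ((p0 + p1 * t + p2 * t ^+ 2) * expR (- t))%:E)%E).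
  apply: ge0_le_integral => //.
  - by move=> t _; rewrite lee_fin gamma_integrand_ge0.
  - by apply/measurable_EFinP/measurable_funTS; exact: measurable_gamma_integrand.
  - exact: measurable_funTS.
  move=> t; rewrite /= in_itv/= andbT => t0; rewrite lee_fin.
  by rewrite ler_wpM2r ?expR_ge0 ?tb.
apply: ge0_subset_integral => //.
- exact: measurable_funTS.
- move=> t; rewrite /= in_itv/= andbT => t0.
  by rewrite lee_fin mulr_ge0 ?expR_ge0// !addr_ge0// mulr_ge0// sqr_ge0.
- by apply: subset_itvr; rewrite bnd_simp.
Qed.

Lemma gamma_integral_le1 (b : R) : 1 <= b <= 2 -> (gamma_integral b <= 1)%E.
Proof.
move=> /andP[b1 b2].
have -> : 1%E = (2 - b + (b - 1) + 2 * 0 : R)%:E by congr _%:E; ring.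
apply: gamma_integral_le_quadratic; rewrite ?subr_ge0// => t t0.
rewrite mul0r addr0 (_ : 2 - b = 1 - (b - 1)); last by ring.
by apply: powR_le_affine => //; lra.
Qed.

(** Write t^(b-1) = t t^(b-2) and apply the mean inequality to the second factor; the integral is
    then at most b - 1. *)
Lemma gamma_integral_le2 (b : R) : 2 <= b <= 3 -> (gamma_integral b <= 2%:E)%E.
Proof.
move=> /andP[b2 b3].
apply: (@le_trans _ _ (0 + (3 - b) + 2 * (b - 2))%:E); last by rewrite lee_fin; lra.
apply: gamma_integral_le_quadratic; rewrite ?subr_ge0// => t t0.
have -> : b - 1 = 1 + (b - 2) by ring.
rewrite powRD ?(gt_eqF t0) ?implybT// powRr1 ?(ltW t0)//.
have -> : 0 + (3 - b) * t + (b - 2) * t ^+ 2 = t * ((1 - (b - 2)) + (b - 2) * t) by ring.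
by rewrite ler_pM2l//; apply: powR_le_affine => //; lra.
Qed.

Definition beta_integrand (a b t : R) : R := t `^ (a - 1) * (1 - t) `^ (b - 1).

Lemma measurable_beta_integrand a b : measurable_fun setT (beta_integrand a b).
Proof.
apply: measurable_funM; first exact: measurable_powR.
by apply: (measurableT_comp (measurable_powR _)); exact: measurable_funB.
Qed.

Lemma beta_integrand_ge0 a b t : 0 <= beta_integrand a b t.
Proof. by rewrite mulr_ge0 ?powR_ge0. Qed.

Lemma continuous_powR (p t : R) : 0 < t -> {for t, continuous (fun x : R => x `^ p)}.
Proof.
move=> t0; apply/differentiable_continuous/derivable1_diffP.
by have := is_derive1_powR p t0; case.
Qed.

(** A compact exhaustion of ]0, 1[, invariant under t -> 1 - t; n + 2 keeps the left end at most
    1/2. *)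
Let A (n : nat) : set R := `[n.+2%:R^-1, 1 - n.+2%:R^-1]%classic.

Let bigcup_A : \bigcup_n A n = `]0, 1[%classic.
Proof.
have n0 n : 0 < n.+2%:R^-1 :> R by rewrite invr_gt0.
apply/seteqP; split => [t [n _]|t].
  by rewrite /A/= !in_itv/= => /andP[]; move: (n0 n); set e := _^-1 => ? ? ?; apply/andP; split; lra.
rewrite /= in_itv/= => /andP[t0 t1].
have c0 : n.+2%:R^-1 @[n --> \oo] --> (0 : R).
  rewrite gtr0_cvgV0; last by near=> n.
  have := @cvgr_idn R; rewrite -(cvg_shiftn 2).
  by under eq_fun do rewrite addn2.
near \oo => n; exists n => //; rewrite /A/= in_itv/=; apply/andP; split.
  by near: n; move/cvgr_le: c0; apply.
rewrite lerBrDl addrC -lerBrDl.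
by near: n; move/cvgr_le: c0; apply; rewrite subr_gt0.
Unshelve. all: end_near. Qed.

Let nondecreasing_A : nondecreasing_seq A.
Proof.
move=> n m nm; apply/subsetPset => x; rewrite /A/= !in_itv/= => /andP[a1 a2].
have h : m.+2%:R^-1 <= n.+2%:R^-1 :> R.
  by rewrite lef_pV2 ?posrE// ler_nat.
by move: h a1 a2; set e := m.+2%:R^-1; set f := n.+2%:R^-1 => ? ? ?; apply/andP; split; lra.
Qed.

Let cvg_A (f : R -> R) : measurable_fun setT f -> (forall t, 0 <= f t) ->
  (\int[mu]_(t in A n) (f t)%:E @[n --> \oo] --> \int[mu]_(t in `]0%R, 1%R[) (f t)%:E)%E.
Proof.
move=> mf f0; rewrite -bigcup_A.
exact: (ge0_nondecreasing_set_cvg_integral (T := measurableTypeR R) (mu := mu)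
  (F := A) (f := EFin \o f) nondecreasing_A (fun n => measurable_itv _)
  (fun n => (measurable_EFinP _ _).2 (measurable_funTS mf)) (fun n x _ => f0 x)).
Qed.

(** [Beta 2 b] has its power b - 1 on 1 - t, whereas the gamma integrand has it on t. The
    substitution t -> 1 - t is made on the compact intervals [A n]. *)
Lemma beta_integral_sym (b : R) :
  (\int[mu]_(t in `]0%R, 1%R[) (beta_integrand 2 b t)%:E =
   \int[mu]_(t in `]0%R, 1%R[) (beta_integrand b 2 t)%:E)%E.
Proof.
have cA := cvg_A (measurable_beta_integrand 2 b) (beta_integrand_ge0 2 b).
have cB := cvg_A (measurable_beta_integrand b 2) (beta_integrand_ge0 b 2).
have E : (fun n => \int[mu]_(t in A n) (beta_integrand 2 b t)%:E)%E =
    (fun n => \int[mu]_(t in A n) (beta_integrand b 2 t)%:E)%E.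
  apply/funext => n; rewrite /A.
  have a0 : 0 < n.+2%:R^-1 :> R by rewrite invr_gt0.
  have a2 : n.+2%:R^-1 <= 2^-1 :> R by rewrite lef_pV2 ?posrE// ler_nat.
  move: a0 a2; set a := n.+2%:R^-1 => a0 a2.
  pose F (t : R) := 1 - t.
  have dF (t : R) : is_derive t (1 : R) F (- 1).
    by rewrite /F; apply: is_derive_eq; ring.
  have F'E : F^`()%classic = cst (- 1).
    by apply/funext => t; rewrite derive1E; have [_] := dF t.
  have cF : continuous F.
    by move=> t; apply: cvgB; [exact: cvg_cst|exact: cvg_id].
  have Fa : F a = 1 - a by [].
  have Fb : F (1 - a) = a by rewrite /F; ring.
  rewrite -{1}Fb -Fa (@integration_by_substitution_decreasing R F)//.
  - apply: eq_integral => t _; rewrite F'E; congr _%:E.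
    rewrite -[LHS]/(beta_integrand 2 b (1 - t) * - (- 1)) opprK mulr1.
    by rewrite /beta_integrand mulrC; congr (_ `^ _ * _); ring.
  - by rewrite Fa; lra.
  - by move=> x y _ _ xy; rewrite /F ltrD2l ltrN2.
  - by rewrite F'E => t _; exact: cvg_cst.
  - by rewrite F'E; exact: is_cvg_cst.
  - by rewrite F'E; exact: is_cvg_cst.
  - split; first by move=> x _; have [] := dF x.
      by apply: cvg_at_right_filter; exact: cF.
    by apply: cvg_at_left_filter; exact: cF.
  - apply: continuous_in_subspaceT => t; rewrite inE/= in_itv/= Fb Fa => /andP[ta tb].
    have t0 : 0 < t by lra.
    have t1 : 0 < 1 - t by lra.
    apply: (@cvgM _ _ _ _ (fun t => t `^ (2 - 1)) (fun t => (1 - t) `^ (b - 1))).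
      exact: continuous_powR.
    apply: (cvg_comp F (fun x : R => x `^ (b - 1))); first exact: cF.
    exact: continuous_powR.
by rewrite E in cA; exact: (cvg_unique _ cA cB).
Qed.

(** Since 1 - t <= 1, the integral of t^(b-1) dominates. This ensures that [Beta 2 b] is the
    integral and not the default value of [fine]. *)
Lemma beta_integral_le (b : R) : 0 < b ->
  (\int[mu]_(t in `]0%R, 1%R[) (beta_integrand b 2 t)%:E <= (b^-1)%:E)%E.
Proof.
move=> b0; have cB := cvg_A (measurable_beta_integrand b 2) (beta_integrand_ge0 b 2).
rewrite -(cvg_lim _ cB)//; apply: lime_le; first by apply: cvgP cB.
near=> n; rewrite /A.
have a0 : 0 < n.+2%:R^-1 :> R by rewrite invr_gt0.
have a2 : n.+2%:R^-1 < 2^-1 :> R.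
  by rewrite ltf_pV2 ?posrE// ltr_nat; near: n; exists 1%N.
move: a0 a2; set a := n.+2%:R^-1 => a0 a2.
have dP (t : R) : 0 < t -> is_derive t (1 : R) (fun t => b^-1 * t `^ b) (t `^ (b - 1)).
  move=> t0; have := is_derive1_powR b t0 => ?.
  by apply: is_derive_eq; rewrite /GRing.scale/=; field; rewrite gt_eqF.
have cP (t : R) : 0 < t -> {for t, continuous (fun t => b^-1 * t `^ b)}.
  by move=> t0; apply/differentiable_continuous/derivable1_diffP; have [] := dP t t0.
apply: (@le_trans _ _ (\int[mu]_(t in `[a, (1 - a)%R]) (t `^ (b - 1))%:E)%E).
  apply: ge0_le_integral => //.
  - by move=> t _; rewrite lee_fin beta_integrand_ge0.
  - by apply/measurable_EFinP/measurable_funTS; exact: measurable_beta_integrand.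
  - by apply/measurable_EFinP/measurable_funTS; exact: measurable_powR.
  - move=> t; rewrite /= in_itv/= => /andP[ta tb]; rewrite lee_fin /beta_integrand.
    rewrite (_ : 2 - 1 = 1); last by ring.
    rewrite powRr1; last by lra.
    by rewrite ler_piMr ?powR_ge0//; lra.
rewrite (@continuous_FTC2 R _ (fun t => b^-1 * t `^ b))//.
- rewrite -EFinB lee_fin -mulrBr ler_piMr ?invr_ge0 ?(ltW b0)//.
  have : (1 - a) `^ b <= 1 `^ b.
    by apply: ge0_ler_powR; rewrite ?nnegrE ?(ltW b0)//; lra.
  by rewrite powR1; have := powR_ge0 a b; lra.
- by lra.
- apply: continuous_in_subspaceT => t; rewrite inE/= in_itv/= => /andP[ta tb].
  by apply: continuous_powR; lra.
- split.
  + move=> t; rewrite in_itv/= => /andP[ta tb].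
    by have [|] := dP t; first lra.
  + by apply: cvg_at_right_filter; apply: cP.
  + by apply: cvg_at_left_filter; apply: cP; lra.
- move=> t; rewrite in_itv/= => /andP[ta tb].
  by rewrite derive1E; have [|_] := dP t; first lra.
Unshelve. all: end_near. Qed.

Lemma expRN_le_quadratic (t : R) : 0 <= t -> expR (- t) <= 1 - t + t ^+ 2 / 2.
Proof.
rewrite le_eqVlt => /predU1P[<-|t0].
  by rewrite oppr0 expR0; lra.
pose f (x : R) := 1 - x + x ^+ 2 / 2 - expR (- x).
have df (x : R) : is_derive x (1 : R) f (x - 1 + expR (- x)).
  by rewrite /f; apply: is_derive_eq; rewrite /GRing.scale/=; field.
have cf : {within `[0, t], continuous f}.
  apply: continuous_subspaceT => x; apply/differentiable_continuous/derivable1_diffP.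
  by have [] := df x.
have [c _] := MVT t0 (fun x _ => df x) cf.
have f0 : f 0 = 0 by rewrite /f oppr0 expR0; lra.
rewrite f0 !subr0 => E.
have : 0 <= (c - 1 + expR (- c)) * t.
  by rewrite mulr_ge0 ?(ltW t0)//; have := expR_ge1Dx (- c); lra.
by rewrite -E /f; lra.
Qed.

(** Split at 1. Beyond 1 the power is at most 1, and the integral at most exp(-1) <= 1/2. Below 1,
    exp(-t) <= 1 - t + t^2/2 gives the beta integrand plus t^(b+1) / 2 <= 1/2. *)
Lemma gamma_integral_le_Beta (b : R) : 0 < b < 1 ->
  (gamma_integral b <= (1 + Beta 2 b)%:E)%E.
Proof.
move=> /andP[b0 b1].
have BE : ((Beta 2 b)%:E = \int[mu]_(t in `]0%R, 1%R[) (beta_integrand b 2 t)%:E)%E.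
  rewrite -beta_integral_sym fineK// ge0_fin_numE.
    by rewrite beta_integral_sym (le_lt_trans (beta_integral_le b0))// ltry.
  by apply: integral_ge0 => t _; rewrite lee_fin beta_integrand_ge0.
have mg D : measurable_fun D (EFin \o gamma_integrand b).
  by apply/measurable_EFinP/measurable_funTS; exact: measurable_gamma_integrand.
have e2 : expR (- 1) <= 2^-1 :> R.
  by rewrite expRN lef_pV2 ?posrE ?expR_gt0//; have := expR_ge1Dx (1:R); lra.
have -> : gamma_integral b = (\int[mu]_(t in `]0%R, 1%R[) (gamma_integrand b t)%:E +
    \int[mu]_(t in `[1%R, +oo[) (gamma_integrand b t)%:E)%E.
  rewrite /gamma_integral (@itv_bndbnd_setU _ _ (BRight 0) (BLeft (1:R)) (BInfty R false)) ?bnd_simp//.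
  rewrite ge0_integral_setU//.
  - exact: mg.
  - by move=> t _; rewrite lee_fin gamma_integrand_ge0.
  - rewrite disj_set2E; apply/eqP; rewrite -subset0 => t [] /=.
    by rewrite !in_itv/= andbT => /andP[_ t1] t2; have := lt_le_trans t1 t2; rewrite ltxx.
have h1 : (\int[mu]_(t in `[1%R, +oo[) (gamma_integrand b t)%:E <= (2^-1)%:E)%E.
  apply: (@le_trans _ _ (expR (- 1))%:E); last by rewrite lee_fin.
  have := @integral_quadratic_expRN 1 0 0 1 ler01 (lexx 0) (lexx 0) ler01.
  rewrite (_ : (1 + 0 + 2 * 0 + (0 + 2 * 0) * 1 + 0 * 1 ^+ 2) * _ = expR (- 1)) => [<-|]; last by ring.
  apply: ge0_le_integral => //.
  - by move=> t _; rewrite lee_fin gamma_integrand_ge0.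
  - exact: mg.
  - by apply: measurable_funTS; exact: measurable_quadratic_expRN.
  move=> t; rewrite /= in_itv/= andbT => t1; rewrite lee_fin !mul0r !addr0.
  rewrite ler_wpM2r ?expR_ge0//.
  by rewrite -[leRHS](powRr0 t); apply: ler_powR => //; lra.
have h2 : (\int[mu]_(t in `]0%R, 1%R[) (gamma_integrand b t)%:E <=
    (2^-1)%:E + (Beta 2 b)%:E)%E.
  rewrite BE.
  have -> : (2^-1)%:E = (\int[mu]_(t in `]0%R, 1%R[) (2^-1)%:E)%E.
    transitivity ((2^-1)%:E * mu `]0%R, 1%R[%classic)%E.
      by rewrite /= lebesgue_measure_itv/= lte_fin ltr01 oppr0 adde0 mule1.
    by apply/esym; apply: integral_cst; exact: measurable_itv.
  rewrite -ge0_integralD//; last 2 first.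
  - by move=> t _; rewrite lee_fin beta_integrand_ge0.
  - by apply/measurable_EFinP/measurable_funTS; exact: measurable_beta_integrand.
  apply: ge0_le_integral => //.
  - by move=> t _; rewrite lee_fin gamma_integrand_ge0.
  - exact: mg.
  - apply: emeasurable_funD => //.
    by apply/measurable_EFinP/measurable_funTS; exact: measurable_beta_integrand.
  move=> t; rewrite /= in_itv/= => /andP[t0 t1].
  rewrite -EFinD lee_fin /gamma_integrand /beta_integrand.
  rewrite (_ : 2 - 1 = 1); last by ring.
  rewrite (powRr1 (_ : 0 <= 1 - t)); last by lra.
  have et := expRN_le_quadratic (ltW t0).
  have p0 := powR_ge0 t (b - 1).
  have p1 : t * t `^ (b - 1) <= 1.
    rewrite mulr_powRB1 ?(ltW t0)//; apply: (@le_trans _ _ (1 `^ b)); last by rewrite powR1.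
    by apply: ge0_ler_powR; rewrite ?nnegrE ?ltW.
  have h3 := ler_wpM2l p0 et.
  have h4 : t * (t * t `^ (b - 1)) <= 1 * 1.
    by apply: ler_pM => //; [exact: ltW|exact: mulr_ge0 (ltW t0) p0|exact: ltW].
  by lra.
have -> : ((1 + Beta 2 b)%:E = ((2^-1)%:E + (Beta 2 b)%:E) + (2^-1)%:E)%E.
  by rewrite -!EFinD; congr _%:E; field.
exact: leeD.
Qed.

End gamma_beta_bounds.

(** * Bounds on the orthant probability *)

Section bounds.
Context (R : realType).
Local Notation Phi := (@std_cdf R).
Local Notation w := (@gauss_weight R).
Local Notation N := (normal_prob (0:R) 1).
Implicit Types (n : nat) (b : R).

Lemma ge0_gamma_integral b : (0 <= gamma_integral b)%E.
Proof. by apply: integral_ge0 => t _; rewrite lee_fin gamma_integrand_ge0. Qed.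

Lemma EFin_Gamma b : (gamma_integral b < +oo)%E -> ((Gamma b)%:E = gamma_integral b)%E.
Proof. by move=> h; rewrite fineK// ge0_fin_numE// ge0_gamma_integral. Qed.

Lemma Gamma_ge0 b : 0 <= Gamma b.
Proof. exact/fine_ge0/ge0_gamma_integral. Qed.

Lemma std_normal_tail v : (N `]v, +oo[%classic = (1 - Phi v)%:E)%E.
Proof. by rewrite -setCitvl EFinB EFin_std_cdf; exact: probability_setC. Qed.

Lemma sqrt2lnn n : (1 <= n)%N -> Num.sqrt (2 * ln n%:R) ^+ 2 = 2 * ln n%:R :> R.
Proof. by move=> n1; rewrite sqr_sqrtr// mulr_ge0// ln_ge0// ler1n. Qed.

Lemma gauss_weight_sqrt2lnn n : (1 <= n)%N ->
  w (Num.sqrt (2 * ln n%:R)) = n%:R^-1.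
Proof.
move=> n1; rewrite /gauss_weight sqrt2lnn// mulrAC mulfV// mul1r expRN lnK//.
by rewrite posrE ltr0n.
Qed.

Lemma std_cdf_ge_half u : 0 <= u -> 1 / 2 <= Phi u.
Proof.
by rewrite -std_cdf0 le_eqVlt => /predU1P[<-//|/std_cdf_lt/ltW].
Qed.

(** At this point 4 Phi (1 - Phi) <= w = 1/n, and Phi >= 1/2. *)
Lemma std_cdf_tail_sqrt2lnn n : (1 <= n)%N ->
  1 - Phi (Num.sqrt (2 * ln n%:R)) <= n%:R^-1 / 2.
Proof.
move=> n1; set v := Num.sqrt _.
have := std_cdf_tail_le v; rewrite -/(gauss_weight v) gauss_weight_sqrt2lnn//.
have h : 1 / 2 <= Phi v by apply: std_cdf_ge_half; exact: sqrtr_ge0.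
have := std_cdf_le1 v.
have : 0 <= (Phi v - 1 / 2) * (1 - Phi v) by rewrite mulr_ge0 ?subr_ge0// std_cdf_le1.
lra.
Qed.

Lemma bernoulli_expr n (x : R) : 0 <= x <= 1 -> 1 - n%:R * x <= (1 - x) ^+ n.
Proof.
move=> /andP[x0 x1]; elim: n => [|n IH]; first by rewrite mul0r subr0 expr0.
rewrite exprS; apply: (@le_trans _ _ ((1 - x) * (1 - n%:R * x))); last first.
  by rewrite ler_wpM2l ?subr_ge0.
have : 0 <= n%:R * x * x by rewrite !mulr_ge0.
by rewrite -[n.+1]addn1 natrD; lra.
Qed.

Section law.
Context (rho : R) (rho01 : 0 < rho < 1) (n : nat).
Context d (T : measurableType d) (P : probability T R) (X : 'I_n -> {RV P >-> R}).
Hypothesis hX : equicorrelated_normal rho X.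
Local Notation b := (1 / rho - 1).
Local Notation al := (Num.sqrt ((1 - rho) / rho)).

Let al0 : 0 < al.
Proof. by have [? ?] := andP rho01; rewrite sqrtr_gt0 divr_gt0// subr_gt0. Qed.

Lemma orthant_prob_ge_Gamma : 1 <= b ->
  al * (4 `^ (b - 1) * (n%:R + 2 * b - 1) `^ (- b) * Gamma b) <= orthant_prob X.
Proof.
move=> b1; rewrite -lee_fin (orthant_probE_integral rho01 hX) EFinM.
apply: lee_wpmul2l; first by rewrite lee_fin ltW.
rewrite EFinM EFin_Gamma ?gamma_integral_lty// EFinM.
exact: gamma_le_orthant_integral.
Qed.

Lemma orthant_prob_le_Gamma : (0 < n)%N -> 0 < b < 1 ->
  orthant_prob X <=
  al * (4 `^ (b - 1) * (n%:R + 2 * b - 1) `^ (- b) * (1 + Beta 2 b)).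
Proof.
move=> n0 b01; have [b0 b1] := andP b01.
rewrite -lee_fin (orthant_probE_integral rho01 hX) EFinM.
apply: lee_wpmul2l; first by rewrite lee_fin ltW.
apply: (le_trans (orthant_integral_le_gamma n0 _)); first by rewrite b0 ltW.
rewrite [leRHS]EFinM EFinM; apply: lee_wpmul2l; last exact: gamma_integral_le_Beta.
by rewrite -EFinM lee_fin mulr_ge0 ?powR_ge0.
Qed.

(** Keep only the values y > al u of the common factor; there t y > u, so Phi(t y)^n exceeds
    Phi(u)^n. *)
Lemma orthant_prob_ge_tail u : 0 <= u ->
  Phi u ^+ n * (1 - Phi (al * u)) <= orthant_prob X.
Proof.
move=> u0; rewrite (orthant_probE rho01 hX).
under eq_Rintegral do rewrite gauss_avg_pos//.
set t := Num.sqrt (rho / (1 - rho)).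
have [rho0 rho1] := andP rho01.
have tal : t * al = 1.
  rewrite -sqrtrM; last by apply: divr_ge0; lra.
  have -> : rho / (1 - rho) * ((1 - rho) / rho) = 1.
    by field; rewrite !gt_eqF// subr_gt0.
  exact: sqrtr1.
have t0 : 0 < t by rewrite sqrtr_gt0 divr_gt0 ?subr_gt0.
have -> : 1 - Phi (al * u) = \int[N]_y \1_(`]al * u, +oo[%classic) y.
  rewrite /Rintegral integral_indic// setIT -[LHS]/(fine (1 - Phi (al * u))%:E).
  by congr fine; exact/esym/std_normal_tail.
have mt : measurable_fun setT (fun y : R => Phi (t * y)).
  by apply: (@measurableT_comp _ _ _ _ _ _ Phi) => //; exact: measurable_std_cdf.
rewrite -RintegralZl//; last by apply: integrable_indic.
apply: le_Rintegral => //.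
- apply: (@bounded_integrable _ _ _ N _ 1) => [|y].
    by apply: measurable_funM => //; exact: measurable_indic.
  rewrite normrM mulr_ile1//.
    by rewrite normrX exprn_ile1// ger0_norm ?std_cdf_ge0 ?std_cdf_le1.
  by rewrite indicE; case: (_ \in _); rewrite ?normr1 ?normr0.
- apply: (@bounded_integrable _ _ _ N _ 1) => [|y].
    exact: measurable_funX mt.
  by rewrite normrX exprn_ile1// ger0_norm ?std_cdf_ge0 ?std_cdf_le1.
move=> y _; rewrite indicE; case: (boolP (y \in _)) => [|_]; last first.
  by rewrite mulr0 exprn_ge0// std_cdf_ge0.
rewrite inE/= in_itv/= andbT => yu; rewrite mulr1 lerXn2r ?nnegrE ?std_cdf_ge0//.
apply/ltW/std_cdf_lt; rewrite -[u]mul1r -tal -mulrA ltr_pM2l//.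
Qed.

End law.

End bounds.

(** * The four bounds *)

Section arithmetic.
Context (R : realType).
Implicit Types (b : R) (n : nat).

Lemma le_powR_base (r x y : R) : 0 <= r -> 0 <= x -> x <= y -> x `^ r <= y `^ r.
Proof.
move=> r0 x0 xy; apply: ge0_ler_powR; rewrite ?nnegrE//; exact: le_trans xy.
Qed.

(** The left side is the factor between the constant of the gamma comparison and the claimed
    2^(b-1). For b >= 1/2 both of its factors are at most 1; for b < 1/2 the fraction is at most 2,
    which leaves 2^(2b-1) <= 1. *)
Lemma powR_ratio_small b n : 0 < b <= 1 -> (2 <= n)%N ->
  2 `^ (b - 1) * (n%:R / (n%:R + 2 * b - 1)) `^ b <= 1.
Proof.
move=> /andP[b0 b1] n2.
have n2R : 2 <= n%:R :> R by rewrite ler_nat.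
have c0 : 0 < n%:R + 2 * b - 1 by lra.
have [b12|b12] := leP (1 / 2) b.
  apply: mulr_ile1; rewrite ?powR_ge0//.
    by rewrite -[leRHS](powRr0 2); apply: ler_powR; lra.
  apply: (@le_trans _ _ (1 `^ b)); last by rewrite powR1.
  apply: le_powR_base; [lra|by rewrite divr_ge0 ?(ltW c0)|].
  by rewrite ler_pdivrMr// mul1r; lra.
apply: (@le_trans _ _ (2 `^ (b - 1) * 2 `^ b)).
  apply: ler_wpM2l; first exact: powR_ge0.
  apply: le_powR_base; [lra|by rewrite divr_ge0 ?(ltW c0)|].
  by rewrite ler_pdivrMr//; lra.
rewrite -powRD; last by rewrite pnatr_eq0 implybT.
by rewrite -[leRHS](powRr0 2); apply: ler_powR; lra.
Qed.

(** Serves to exclude small n: 2^n <= n^2 for 2 <= n <= 4 and 2^n <= n^3 for 2 <= n <= 9, so b > 2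
    forces n >= 5 and b > 3 forces n >= 10. *)
Lemma ln_bound_small n (k : nat) b : (2 <= n)%N -> (2 ^ n <= n ^ k)%N ->
  b * ln n%:R / ln 2 <= n%:R -> b <= k%:R.
Proof.
move=> n2 nk; have l2 : 0 < ln 2 :> R by rewrite ln_gt0// ltr1n.
have ln0 : 0 < ln n%:R :> R by rewrite ln_gt0// ltr1n.
rewrite ler_pdivrMr// => h.
have : n%:R * ln 2 <= k%:R * ln n%:R :> R.
  rewrite !mulr_natl -!lnXn ?ltr0n//; last exact: ltnW.
  rewrite ler_ln ?posrE ?exprn_gt0 ?ltr0n//; last exact: ltnW.
  by rewrite -!natrX ler_nat.
move=> h2; rewrite -(ler_pM2r ln0); exact: le_trans h h2.
Qed.

(** As n >= 5 and b <= 3, n + 2b - 1 <= 2n; the right side is half of a b-th power with base at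
    least 1. *)
Lemma powR_ratio_half b n : 2 < b <= 3 -> (2 <= n)%N ->
  b * ln n%:R / ln 2 <= n%:R ->
  1 / 2 <= 2 `^ (b - 1) * (n%:R / (n%:R + 2 * b - 1)) `^ b.
Proof.
move=> /andP[b2 b3] n2 h.
have n5 : (5 <= n)%N.
  rewrite leqNgt; apply/negP => n5; suff : b <= 2%:R by move=> ?; lra.
  by apply: (ln_bound_small n2 _ h); case: n n2 n5 {h} => [|[|[|[|[|]]]]].
have n5R : 5 <= n%:R :> R by rewrite ler_nat.
have c0 : 0 < n%:R + 2 * b - 1 by lra.
have -> : 2 `^ (b - 1) * (n%:R / (n%:R + 2 * b - 1)) `^ b =
    (2 * (n%:R / (n%:R + 2 * b - 1))) `^ b / 2.
  rewrite [in RHS]powRM//; last by rewrite divr_ge0 ?(ltW c0).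
  by rewrite powRB ?pnatr_eq0 ?implybT// powRr1//; ring.
rewrite ler_pM2r//; apply: (@le_trans _ _ (1 `^ b)); first by rewrite powR1.
apply: le_powR_base; [lra|by []|].
by rewrite mulrA ler_pdivlMr// mul1r; lra.
Qed.

(* The bound n + 2b - 1 <= 79/50 * n suffices, as (100/79)^3 > 2. *)
Lemma powR_ratio_one b n : 3 < b -> (2 <= n)%N ->
  b * ln n%:R / ln 2 <= n%:R ->
  1 <= 2 `^ (b - 1) * (n%:R / (n%:R + 2 * b - 1)) `^ b.
Proof.
move=> b3 n2 h.
have l2 : 0 < ln 2 :> R by rewrite ln_gt0// ltr1n.
have n10 : (10 <= n)%N.
  rewrite leqNgt; apply/negP => n10; suff : b <= 3%:R by move=> ?; lra.
  by apply: (ln_bound_small n2 _ h);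
    case: n n2 n10 {h} => [|[|[|[|[|[|[|[|[|[|]]]]]]]]]].
have n10R : 10 <= n%:R :> R by rewrite ler_nat.
have h1 : b * ln n%:R <= n%:R * ln 2 by move: h; rewrite ler_pdivrMr.
have cn : n%:R + 2 * b - 1 <= 79 / 50 * n%:R.
  (* For n >= 16, ln n >= 4 ln 2 gives b <= n/4. For 10 <= n <= 15, 2^33 <= 10^10 gives b <= 10n/33,
     and the -1 covers the remaining excess because n <= 15. *)
  have [n16|n16] := leqP 16 n.
    have : 4 * ln 2 <= ln n%:R :> R.
      rewrite mulr_natl -lnXn// ler_ln ?posrE ?exprn_gt0 ?ltr0n//; last exact: leq_trans n2.
      by rewrite -natrX ler_nat.
    move=> l4; have : b * (4 * ln 2) <= n%:R * ln 2.
      by apply: le_trans h1; rewrite ler_pM2l//; lra.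
    rewrite mulrA ler_pM2r// => h4; lra.
  have n15 : n%:R <= 15 :> R by rewrite ler_nat.
  have : 33 * ln 2 <= 10 * ln n%:R :> R.
    rewrite !mulr_natl -!lnXn ?ltr0n//; last exact: leq_trans n2.
    apply: (@le_trans _ _ (ln (10 ^+ 10))).
      rewrite ler_ln ?posrE ?exprn_gt0//; lra.
    by rewrite ler_ln ?posrE ?exprn_gt0 ?ltr0n ?lerXn2r ?nnegrE//; exact: leq_trans n2.
  move=> l33; have : b * (33 * ln 2) <= 10 * n%:R * ln 2.
    apply: (@le_trans _ _ (b * (10 * ln n%:R))); first by rewrite ler_pM2l//; lra.
    by lra.
  rewrite mulrA ler_pM2r// => h4; lra.
have c0 : 0 < n%:R + 2 * b - 1 by lra.
apply: (@le_trans _ _ (2 `^ (b - 1) * (50 / 79) `^ b)); last first.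
  apply: ler_wpM2l; first exact: powR_ge0.
  apply: le_powR_base; [lra|by rewrite divr_ge0|].
  by rewrite ler_pdivlMr//; lra.
have -> : 2 `^ (b - 1) * (50 / 79) `^ b = (100 / 79) `^ b / 2 :> R.
  have -> : 100 / 79 = 2 * (50 / 79) :> R by field.
  by rewrite [in RHS]powRM ?divr_ge0// powRB ?pnatr_eq0 ?implybT// powRr1//; ring.
rewrite ler_pdivlMr// mul1r; apply: (@le_trans _ _ ((100 / 79) `^ 3%:R)).
  by rewrite powR_mulrn ?divr_ge0//; lra.
by apply: ler_powR; lra.
Qed.

End arithmetic.

(** * The upper bound with a logarithm *)

Section upper.
Context (R : realType).
Local Notation mu := (@lebesgue_measure R).
Local Notation phi := (@std_pdf R).
Local Notation Phi := (@std_cdf R).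
Local Notation Y := (@neg_ln_cdf R).
Local Notation w := (@gauss_weight R).

(** The constant for which [std_cdf_tail_ge] reads w(u) <= K (1 + u) (1 - Phi(u)). *)
Definition mills_const : R := Num.sqrt (2 * pi) * expR (3 / 2).
Local Notation K := mills_const.

Lemma mills_const_ge2 : 2 <= K.
Proof.
have s2 : 2 <= Num.sqrt (2 * pi) :> R.
  rewrite -[leLHS](@ger0_norm R 2)// -sqrtr_sqr ler_wsqrtr//.
  by have := pi_ge2 R; lra.
have e1 : 1 <= expR (3 / 2) :> R by have := expR_ge1Dx (3 / 2 : R); lra.
by rewrite -[leLHS]mulr1; apply: ler_pM.
Qed.

Lemma tail_le_neg_ln_cdf u : 1 - Phi u <= Y u.
Proof. by have := expR_ge1Dx (- Y u); rewrite expR_neg_ln_cdf; lra. Qed.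

(** For u >= 0 this is the Mills bound followed by 1 - Phi <= Y. For u < 0, Y >= 1 - Phi >= 1/2 and
    K >= 2 make the right side at least 1. *)
Lemma gauss_weight_le_neg_ln_cdf u v : 0 <= v -> u <= v ->
  w u <= K * (1 + v) * Y u.
Proof.
move=> v0 uv; have Y0 := neg_ln_cdf_gt0 u; have K2 := mills_const_ge2.
have tY := tail_le_neg_ln_cdf u.
have [u0|u0] := leP 0 u.
  apply: (@le_trans _ _ (K * (1 + u) * Y u)); last first.
    by rewrite ler_pM2r// ler_pM2l//; lra.
  have s0 : 0 < Num.sqrt (2 * pi) :> R by rewrite sqrtr_gt0 mulr_gt0 ?pi_gt0.
  have e0 := expR_gt0 (3 / 2 : R).
  have -> : w u = K * (1 + u) * (phi u * (expR (- (3 / 2)) / (1 + u))).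
    rewrite /std_pdf -/(gauss_weight u) expRN /mills_const.
    by field; rewrite !gt_eqF//; lra.
  apply: ler_wpM2l; first by rewrite mulr_ge0; lra.
  exact: le_trans (std_cdf_tail_ge u0) tY.
have P0 : Phi u <= 1 / 2 by rewrite -std_cdf0; apply/ltW/std_cdf_lt.
apply: (le_trans (gauss_weight_le1 u)).
have : 0 <= (K - 2) * Y u by rewrite mulr_ge0 ?subr_ge0// ltW.
have : 0 <= K * v * Y u by rewrite !mulr_ge0// ?ltW//; lra.
by lra.
Qed.

(* The weight w^(b-1) is bounded by a power of Y to the left of v, and by
   n^-(b-1) to its right. *)
Lemma orthant_integral_upper n b (v := Num.sqrt (2 * ln n%:R) : R) :
  (1 <= n)%N -> 1 <= b ->
  (orthant_integral n b <=
   ((K * (1 + v)) `^ (b - 1))%:E * (((n%:R + 1) `^ (- b))%:E * gamma_integral b) +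
   (n%:R `^ (- (b - 1)) * (1 - Phi v))%:E)%E.
Proof.
move=> n1 b1; have v0 : 0 <= v by exact: sqrtr_ge0.
have n0 : 0 < n%:R :> R by rewrite ltr0n.
have K2 := mills_const_ge2.
have K0 : 0 <= K * (1 + v) by rewrite mulr_ge0; lra.
have np : 0 <= n%:R `^ (- (b - 1)) by exact: powR_ge0.
(* With c = n + 1 the substitution formula contains exactly Phi^(c-1) = Phi^n. *)
rewrite (@gamma_part R b (n%:R + 1)); last by lra.
rewrite -ge0_integralZl//; last 3 first.
- have := @measurable_gamma_part R b (n%:R + 1 - 1) 1.
  by under eq_fun do rewrite mul1r.
- by move=> u _; rewrite lee_fin !mulr_ge0 ?powR_ge0 ?expR_ge0 ?std_pdf_ge0.
- by rewrite lee_fin powR_ge0.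
have mtail : measurable_fun setT (fun u : R => (phi u * \1_(`]v, +oo[%classic) u)%:E).
  apply/measurable_EFinP; apply: measurable_funM; first exact: measurable_std_pdf.
  exact: measurable_indic.
have -> : ((n%:R `^ (- (b - 1)) * (1 - Phi v))%:E =
    \int[mu]_u ((n%:R `^ (- (b - 1)))%:E * (phi u * \1_(`]v, +oo[%classic) u)%:E))%E.
  rewrite ge0_integralZl//; last first.
    by move=> u _; rewrite lee_fin mulr_ge0 ?std_pdf_ge0.
  rewrite EFinM; congr (_ * _)%E.
  rewrite -std_normal_tail /normal_prob std_pdfE [LHS]integral_mkcond.
  apply: eq_integral => u _; rewrite patchE indicE; case: ifPn => _.
    by rewrite mulr1.
  by rewrite mulr0.
rewrite -ge0_integralD//; last 4 first.
- by move=> u _; rewrite -EFinM lee_fin !mulr_ge0 ?powR_ge0 ?expR_ge0 ?std_pdf_ge0.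
- by under eq_fun do rewrite -EFinM; exact: measurable_gamma_part.
- by move=> u _; rewrite -EFinM lee_fin !mulr_ge0 ?std_pdf_ge0.
- exact: measurable_funeM.
apply: ge0_le_integral => //.
- by move=> u _; rewrite lee_fin !mulr_ge0 ?exprn_ge0 ?std_cdf_ge0 ?powR_ge0 ?std_pdf_ge0.
- exact: measurable_orthant_part.
- apply: emeasurable_funD; last exact: measurable_funeM.
  by under eq_fun do rewrite -EFinM; exact: measurable_gamma_part.
move=> u _; rewrite -!EFinM -EFinD lee_fin.
have [uv|vu] := leP u v.
  rewrite indicE memNset ?mulr0 ?addr0; last by rewrite /= in_itv/= andbT ltNge uv.
  have -> : Phi u ^+ n = expR (- (n%:R * Y u)).
    by rewrite -[in LHS]expR_neg_ln_cdf -expRM_natl mulrN.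
  rewrite addrK -[leLHS]mulrA.
  have -> : (K * (1 + v)) `^ (b - 1) * (Y u `^ (b - 1) * expR (- (n%:R * Y u)) * phi u) =
    expR (- (n%:R * Y u)) * ((K * (1 + v)) `^ (b - 1) * Y u `^ (b - 1) * phi u).
    ring.
  rewrite ler_pM2l ?expR_gt0// ler_pM2r ?std_pdf_gt0//.
  rewrite -powRM ?(ltW (neg_ln_cdf_gt0 _))//.
  apply: le_powR_base; [lra|exact/ltW/gauss_weight_gt0|].
  exact: gauss_weight_le_neg_ln_cdf.
apply: ler_wpDl.
  by rewrite !mulr_ge0 ?powR_ge0 ?expR_ge0 ?std_pdf_ge0.
rewrite indicE mem_set ?mulr1; last by rewrite /= in_itv/= andbT.
rewrite ler_pM2r ?std_pdf_gt0//.
apply: (@le_trans _ _ (1 * n%:R^-1 `^ (b - 1))); last first.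
  by rewrite mul1r powRN -powR_inv1 ?ler0n// -powRrM mulN1r powRN.
apply: ler_pM; rewrite ?exprn_ge0 ?std_cdf_ge0 ?powR_ge0//.
  by rewrite exprn_ile1 ?std_cdf_ge0 ?std_cdf_le1.
apply: le_powR_base; [lra|exact/ltW/gauss_weight_gt0|].
rewrite -gauss_weight_sqrt2lnn// /gauss_weight ler_expR lerN2 ler_pM2r//.
by rewrite ler_sqr ?nnegrE ?(ltW vu)// (le_trans v0)// ltW.
Qed.

End upper.

Section constants.
Context (R : realType).

Lemma sqrt2x_affine_le (x : R) : 1 <= x -> 1 + Num.sqrt (2 * x) <= 3 * x.
Proof.
move=> x1; have : Num.sqrt (2 * x) <= 2 * x; last by lra.
rewrite -[leRHS]ger0_norm; last by lra.
rewrite -sqrtr_sqr ler_wsqrtr// expr2 ler_peMl; lra.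
Qed.

(** As k x >= 1, the summand 1 turns [G] into G + 1, which enters the power as its (b-1)-th root; by
    hypothesis [k] times this root is at most [x]. *)
Lemma powR_absorb (b G k x : R) : 1 < b -> 0 <= G -> 1 <= k -> 1 <= x ->
  k * (G + 1) `^ (1 / (b - 1)) <= x ->
  (k * x) `^ (b - 1) * G + 1 <= (b * x ^+ 2) `^ (b - 1).
Proof.
move=> b1 G0 k1 x1 kx; have c0 : 0 < b - 1 by lra.
have kx1 : 1 <= k * x by rewrite -[leLHS]mulr1; apply: ler_pM; lra.
have p1 : 1 <= (k * x) `^ (b - 1).
  by have := @le_powR_base R (b - 1) 1 (k * x); rewrite powR1; apply; lra.
apply: (@le_trans _ _ ((k * x) `^ (b - 1) * (G + 1))); first by lra.
have -> : G + 1 = ((G + 1) `^ (1 / (b - 1))) `^ (b - 1).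
  by rewrite -powRrM mul1r mulVf ?powRr1 ?gt_eqF//; lra.
rewrite -powRM ?powR_ge0//; last by lra.
have g0 := powR_ge0 (G + 1) (1 / (b - 1)).
apply: le_powR_base; [lra|rewrite mulr_ge0//; lra|].
apply: (@le_trans _ _ (x * x)).
  by rewrite mulrAC; apply: ler_pM => //; [rewrite mulr_ge0//|]; lra.
by rewrite -expr2 ler_peMl ?sqr_ge0//; lra.
Qed.

End constants.

Section bounds.
Context (R : realType).
Local Notation Phi := (@std_cdf R).
Local Notation K := (mills_const R).
Context (rho : R) (rho01 : 0 < rho < 1) (n : nat).
Context d (T : measurableType d) (P : probability T R) (X : 'I_n -> {RV P >-> R}).
Hypothesis hX : equicorrelated_normal rho X.
Local Notation b := (1 / rho - 1).
Local Notation al := (Num.sqrt ((1 - rho) / rho)).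

Lemma orthant_ratioE : orthant_prob X / n%:R `^ (1 - 1 / rho) = orthant_prob X * n%:R `^ b.
Proof. by rewrite -powRN opprB. Qed.

(** Multiplication by n^b leaves (n / (n + 1))^b <= 1 in the gamma term and n (1 - Phi(v)) <= 1/2 in
    the tail term. *)
Lemma orthant_prob_le_log : (1 <= n)%N -> 1 < b ->
  orthant_prob X * n%:R `^ b <=
  al * ((K * (1 + Num.sqrt (2 * ln n%:R))) `^ (b - 1) * Gamma b + 1).
Proof.
move=> n1 b1; set v := Num.sqrt (2 * _); set k := K * (1 + v).
have n0 : 0 < n%:R :> R by rewrite ltr0n.
have al0 : 0 <= al by exact: sqrtr_ge0.
have G0 := Gamma_ge0 b.
have : orthant_prob X <=
    al * (k `^ (b - 1) * ((n%:R + 1) `^ (- b) * Gamma b) + n%:R `^ (- (b - 1)) * (1 - Phi v)).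
  rewrite -lee_fin (orthant_probE_integral rho01 hX) EFinM.
  apply: lee_wpmul2l; first by rewrite lee_fin.
  apply: (le_trans (orthant_integral_upper n1 (ltW b1))).
  by rewrite -EFin_Gamma ?gamma_integral_lty ?(ltW b1)// -!EFinM -EFinD.
move=> h.
apply: (le_trans (ler_wpM2r (powR_ge0 _ _) h)).
rewrite -mulrA; apply: ler_wpM2l => //; rewrite mulrDl; apply: lerD.
  have -> : k `^ (b - 1) * ((n%:R + 1) `^ (- b) * Gamma b) * n%:R `^ b =
      (k `^ (b - 1) * Gamma b) * ((n%:R + 1) `^ (- b) * n%:R `^ b) by ring.
  rewrite -[leRHS]mulr1; apply: ler_wpM2l; first by rewrite mulr_ge0 ?powR_ge0.
  rewrite -[leRHS](mulVf (_ : (n%:R + 1) `^ b != 0)); last first.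
    by rewrite gt_eqF// powR_gt0; lra.
  rewrite powRN ler_wpM2l ?invr_ge0 ?powR_ge0//.
  by apply: le_powR_base; lra.
have -> : n%:R `^ (- (b - 1)) * (1 - Phi v) * n%:R `^ b =
    n%:R `^ (- (b - 1)) * n%:R `^ b * (1 - Phi v) by ring.
rewrite -powRD ?(gt_eqF n0) ?implybT//.
have -> : - (b - 1) + b = 1 by ring.
rewrite powRr1 ?ler0n//.
apply: (le_trans (ler_wpM2l (ltW n0) (std_cdf_tail_sqrt2lnn R n1))).
by rewrite mulrA mulfV ?gt_eqF//; lra.
Qed.

End bounds.

(** At a = al sqrt (2 ln n) the Gaussian factor is exactly n^(-b). *)
Lemma std_pdf_pow_ln (R : realType) (b a : R) n : (1 <= n)%N ->
  a ^+ 2 = 2 * (b * ln n%:R) -> std_pdf a * n%:R `^ b = (Num.sqrt (2 * pi))^-1.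
Proof.
move=> n1 a2; have n0 : n%:R != 0 :> R by rewrite pnatr_eq0 -lt0n.
have -> : n%:R `^ b = expR (b * ln n%:R) :> R by rewrite /powR (negbTE n0).
have -> : b * ln n%:R = a ^+ 2 / 2 by rewrite a2; field.
by rewrite /std_pdf -mulrA -expRD addNr expR0 mulr1.
Qed.

Lemma powR_ratioE (R : realType) (b c : R) n : 0 < c ->
  4 `^ (b - 1) * c `^ (- b) * n%:R `^ b =
  2 `^ (b - 1) * (2 `^ (b - 1) * (n%:R / c) `^ b).
Proof.
move=> c0; rewrite powRM ?ler0n ?invr_ge0 ?(ltW c0)//.
have -> : 4 `^ (b - 1) = 2 `^ (b - 1) * 2 `^ (b - 1) :> R.
  by rewrite -powRM//; congr (_ `^ _); lra.
rewrite -powR_inv1 ?(ltW c0)// -powRrM mulN1r; ring.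
Qed.

(** * The remaining bounds on the normalised probability *)

Section ratio_bounds.
Context (R : realType).
Local Notation phi := (@std_pdf R).
Local Notation Phi := (@std_cdf R).
Context (rho : R) (rho01 : 0 < rho < 1) (n : nat) (n2 : (2 <= n)%N).
Context d (T : measurableType d) (P : probability T R) (X : 'I_n -> {RV P >-> R}).
Hypothesis hX : equicorrelated_normal rho X.
Local Notation b := (1 / rho - 1).
Local Notation al := (Num.sqrt ((1 - rho) / rho)).

Let b0 : 0 < b.
Proof.
have [rho0 rho1] := andP rho01.
by rewrite subr_gt0 div1r invf_gt1.
Qed.

Let al2 : al ^+ 2 = b.
Proof.
have [rho0 rho1] := andP rho01; rewrite sqr_sqrtr; last by apply: divr_ge0; lra.
by field; rewrite gt_eqF.
Qed.

Let prefactorE : 1 / 2 `^ (2 - 1 / rho) = 2 `^ (b - 1) :> R.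
Proof. by rewrite div1r -powRN; congr (_ `^ _); ring. Qed.

Let n2R : 2 <= n%:R :> R. Proof. by rewrite ler_nat. Qed.

(** At u = sqrt (2 ln n), Bernoulli's inequality gives Phi(u)^n >= 1/2, and phi(al u) cancels n^b.
    The tail bound leaves 1 / (1 + al u), where 1 + al u <= 2 sqrt (2 + b ln n). These two factors 2
    make the 4 of the constant. *)
Lemma orthant_ratio_ge_log :
  expR (- (3 / 2)) / (4 * Num.sqrt (2 * pi)) / Num.sqrt (2 + b * ln n%:R)
  <= orthant_prob X / n%:R `^ (1 - 1 / rho).
Proof.
have n1 : (1 <= n)%N by exact: ltnW.
rewrite orthant_ratioE; pose u : R := Num.sqrt (2 * ln n%:R).
have u0 : 0 <= u by exact: sqrtr_ge0.
have al0 : 0 <= al by exact: sqrtr_ge0.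
have ln0 : 0 <= ln n%:R :> R by rewrite ln_ge0// ler1n.
pose a := al * u; have a0 : 0 <= a by exact: mulr_ge0.
have a2 : a ^+ 2 = 2 * (b * ln n%:R) by rewrite exprMn al2 sqrt2lnn//; ring.
have bl0 : 0 <= b * ln n%:R by rewrite mulr_ge0// ltW.
have s0 : 0 < Num.sqrt (2 * pi) :> R by rewrite sqrtr_gt0 mulr_gt0 ?pi_gt0.
have r0 : 0 < Num.sqrt (2 + b * ln n%:R) by rewrite sqrtr_gt0; lra.
have Phin : 1 / 2 <= Phi u ^+ n.
  have tu := std_cdf_tail_sqrt2lnn R n1; rewrite -/u in tu.
  have iv : n%:R^-1 <= 1 :> R by rewrite invf_le1 ?ltr0n// ler1n.
  have iv0 : 0 <= n%:R^-1 :> R by rewrite invr_ge0.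
  have x01 : 0 <= (n%:R^-1 / 2 : R) <= 1 by apply/andP; split; lra.
  apply: (@le_trans _ _ ((1 - n%:R^-1 / 2) ^+ n)).
    apply: le_trans (bernoulli_expr n x01).
    by rewrite mulrA mulfV ?pnatr_eq0 -?lt0n//; lra.
  rewrite lerXn2r ?nnegrE ?std_cdf_ge0//; lra.
have a_le : 1 + a <= 2 * Num.sqrt (2 + b * ln n%:R).
  rewrite -[leLHS]ger0_norm ?addr_ge0// -sqrtr_sqr.
  have -> : 2 * Num.sqrt (2 + b * ln n%:R) = Num.sqrt (2 ^+ 2 * (2 + b * ln n%:R)).
    by rewrite sqrtrM ?sqr_ge0// sqrtr_sqr ger0_norm.
  rewrite ler_wsqrtr//.
  by have := sqr_ge0 (1 - a); rewrite !sqrrD sqrrN; lra.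
have tail := orthant_prob_ge_tail rho01 hX u0; rewrite -/a in tail.
have tail2 := std_cdf_tail_ge a0.
have e0 := expR_gt0 (- (3 / 2) : R).
have nb0 : 0 < n%:R `^ b :> R by rewrite powR_gt0// ltr0n.
apply: (@le_trans _ _ (1 / 2 * (phi a * (expR (- (3 / 2)) / (1 + a))) * n%:R `^ b)).
  have -> : 1 / 2 * (phi a * (expR (- (3 / 2)) / (1 + a))) * n%:R `^ b =
      expR (- (3 / 2)) / 2 / (1 + a) * (phi a * n%:R `^ b) by ring.
  rewrite (std_pdf_pow_ln n1 a2).
  have -> : expR (- (3 / 2)) / (4 * Num.sqrt (2 * pi)) / Num.sqrt (2 + b * ln n%:R) =
      expR (- (3 / 2)) / 2 / (2 * Num.sqrt (2 + b * ln n%:R)) / Num.sqrt (2 * pi).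
    by field; rewrite !gt_eqF.
  rewrite ler_wpM2r ?invr_ge0 ?(ltW s0)// ler_wpM2l//.
  by rewrite lef_pV2 ?posrE//; lra.
apply: ler_wpM2r; first exact: ltW.
apply: le_trans tail; apply: ler_pM => //.
by rewrite mulr_ge0 ?std_pdf_ge0// divr_ge0 ?(ltW e0)//; lra.
Qed.

Lemma orthant_ratio_le_Beta : b < 1 ->
  orthant_prob X / n%:R `^ (1 - 1 / rho)
  <= 1 / 2 `^ (2 - 1 / rho) * al * (1 + Beta 2 b).
Proof.
move=> b1; rewrite orthant_ratioE prefactorE.
have n1 : (0 < n)%N by exact: ltnW.
have b01 : 0 < b < 1 by rewrite b0.
have B0 : 0 <= 1 + Beta 2 b.
  have : (0 <= (1 + Beta 2 b)%:E)%E.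
    by apply: le_trans (gamma_integral_le_Beta b01); exact: ge0_gamma_integral.
  by rewrite lee_fin.
have h := orthant_prob_le_Gamma rho01 hX n1 b01.
apply: (le_trans (ler_wpM2r (powR_ge0 _ _) h)).
have c0 : 0 < n%:R + 2 * b - 1 by have := n2R; have := b0; lra.
set B := 1 + Beta _ _; set c := n%:R + _ - _.
have -> : al * (4 `^ (b - 1) * c `^ (- b) * B) * n%:R `^ b =
  al * B * (4 `^ (b - 1) * c `^ (- b) * n%:R `^ b) by ring.
rewrite powR_ratioE//.
have -> : 2 `^ (b - 1) * al * B = al * B * (2 `^ (b - 1) * 1) by ring.
apply: ler_wpM2l; first by rewrite mulr_ge0 ?sqrtr_ge0.
apply: ler_wpM2l; first exact: powR_ge0.
by apply: powR_ratio_small => //; rewrite b0 ltW.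
Qed.

(** The claim reduces to q Gamma(b) >= Gamma(b) - 1. For b <= 2, Gamma(b) <= 1; for 2 < b <= 3, q >=
    1/2 and Gamma(b) <= 2; for b > 3, q >= 1. *)
Lemma orthant_ratio_ge_Gamma : 1 < b -> b * ln n%:R / ln 2 <= n%:R ->
  1 / 2 `^ (2 - 1 / rho) * al * (Gamma b - 1)
  <= orthant_prob X / n%:R `^ (1 - 1 / rho).
Proof.
move=> b1 hn; rewrite orthant_ratioE prefactorE.
have G0 := Gamma_ge0 b.
have GE := EFin_Gamma (gamma_integral_lty (ltW b1)).
have h := orthant_prob_ge_Gamma rho01 hX (ltW b1).
apply: le_trans (ler_wpM2r (powR_ge0 _ _) h).
set c := n%:R + _ - _; have c0 : 0 < c by rewrite /c; have := n2R; lra.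
have -> : al * (4 `^ (b - 1) * c `^ (- b) * Gamma b) * n%:R `^ b =
  al * Gamma b * (4 `^ (b - 1) * c `^ (- b) * n%:R `^ b) by ring.
rewrite powR_ratioE//; set q := 2 `^ (b - 1) * (n%:R / c) `^ b.
have q0 : 0 <= q by rewrite mulr_ge0 ?powR_ge0.
have -> : al * Gamma b * (2 `^ (b - 1) * q) = 2 `^ (b - 1) * al * (q * Gamma b) by ring.
apply: ler_wpM2l; first by rewrite mulr_ge0 ?powR_ge0 ?sqrtr_ge0.
have qG : 0 <= q * Gamma b by exact: mulr_ge0.
have [b2|b2] := leP b 2.
  suff : Gamma b <= 1 by lra.
  by rewrite -lee_fin GE gamma_integral_le1// (ltW b1).
have [b3|b3] := leP b 3.
  have : Gamma b <= 2 by rewrite -lee_fin GE gamma_integral_le2// (ltW b2).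
  have b23 : 2 < b <= 3 by rewrite b2.
  have : 0 <= (q - 1 / 2) * Gamma b.
    by rewrite mulr_ge0// subr_ge0; exact: powR_ratio_half b23 n2 hn.
  lra.
have : 0 <= (q - 1) * Gamma b.
  by rewrite mulr_ge0// subr_ge0; exact: powR_ratio_one b3 n2 hn.
lra.
Qed.

End ratio_bounds.

(* Since x = ln n tends to infinity, one of the two factors x in (b * x^2)^(b-1)
   absorbs Gamma b and the constant of orthant_integral_upper. *)
Lemma orthant_ratio_le_log (R : realType) (rho : R) : 0 < rho < 1 -> rho < 1 / 2 ->
  exists n0 : nat, forall n : nat, (n0 <= n)%N ->
    forall (d : measure_display) (T : measurableType d) (P : probability T R)
      (X : 'I_n -> {RV P >-> R}), equicorrelated_normal rho X ->
    orthant_prob X / n%:R `^ (1 - 1 / rho)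
      <= Num.sqrt ((1 - rho) / rho) * ((1 / rho - 1) * ln n%:R ^+ 2) `^ (1 / rho - 2).
Proof.
move=> rho01 rho2; have [rho0 rho1] := andP rho01.
pose b := 1 / rho - 1.
have b1 : 1 < b.
  by rewrite /b ltrBrDr ltr_pdivlMr//; lra.
have -> : 1 / rho - 2 = b - 1 by rewrite /b; ring.
have K2 := mills_const_ge2 R.
have G0 := Gamma_ge0 b.
pose K := mills_const R.
(* For ln n >= M, the 1 yields ln n >= 1 and the rest is the hypothesis of [powR_absorb] with k =
   3K; the 3 comes from 1 + sqrt (2x) <= 3x. *)
pose M : R := 1 + 3 * K * (Gamma b + 1) `^ (1 / (b - 1)).
have M1 : 1 <= M by rewrite lerDl mulr_ge0 ?powR_ge0//; rewrite /K; lra.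
exists (Num.truncn (expR M)).+1 => n n0n d T P X hX.
have Mn : expR M < n%:R.
  by apply: (lt_le_trans (truncnS_gt _)); rewrite ler_nat.
have n0 : 0 < n%:R :> R by exact: lt_trans (expR_gt0 M) Mn.
have Mln : M <= ln n%:R by rewrite -[M]expRK ler_ln ?posrE ?expR_gt0// ltW.
have n1 : (1 <= n)%N by rewrite -(ltr0n R).
rewrite orthant_ratioE.
apply: (le_trans (orthant_prob_le_log rho01 hX n1 b1)).
apply: ler_wpM2l; first exact: sqrtr_ge0.
have x1 : 1 <= ln n%:R :> R by exact: le_trans M1 Mln.
apply: le_trans (powR_absorb b1 G0 _ x1 _); last 2 first.
- have h : 1 <= 3 * K by rewrite /K; lra.
  exact: h.
- by apply: le_trans Mln; rewrite /M; lra.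
rewrite -/b lerD2r ler_wpM2r//; apply: le_powR_base; first by lra.
  by rewrite mulr_ge0 ?addr_ge0 ?sqrtr_ge0//; lra.
have -> : 3 * K * ln n%:R = K * (3 * ln n%:R) by ring.
apply: ler_wpM2l; first by rewrite /K; lra.
exact: sqrt2x_affine_le.
Qed.

Theorem theorem2p1 (R : realType) :
  (exists c1 : R, 0 < c1 /\
     forall rho : R, 0 < rho < 1 -> 1 / 2 < rho ->
     forall n : nat, (2 <= n)%N ->
     forall (d : measure_display) (T : measurableType d) (P : probability T R)
       (X : 'I_n -> {RV P >-> R}), equicorrelated_normal rho X ->
       c1 / Num.sqrt (2 + (1 / rho - 1) * ln n%:R)
         <= orthant_prob X / n%:R `^ (1 - 1 / rho)
       /\
       orthant_prob X / n%:R `^ (1 - 1 / rho)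
         <= 1 / 2 `^ (2 - 1 / rho) * Num.sqrt ((1 - rho) / rho)
            * (1 + Beta 2 (1 / rho - 1)))
  /\
  (forall rho : R, 0 < rho < 1 -> rho < 1 / 2 ->
     (forall n : nat, (2 <= n)%N ->
      (1 / rho - 1) * ln n%:R / ln 2 <= n%:R ->
      forall (d : measure_display) (T : measurableType d) (P : probability T R)
        (X : 'I_n -> {RV P >-> R}), equicorrelated_normal rho X ->
        1 / 2 `^ (2 - 1 / rho) * Num.sqrt ((1 - rho) / rho)
            * (Gamma (1 / rho - 1) - 1)
          <= orthant_prob X / n%:R `^ (1 - 1 / rho))
     /\
     (exists n0 : nat, forall n : nat, (n0 <= n)%N ->
      forall (d : measure_display) (T : measurableType d) (P : probability T R)
        (X : 'I_n -> {RV P >-> R}), equicorrelated_normal rho X ->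
        orthant_prob X / n%:R `^ (1 - 1 / rho)
          <= Num.sqrt ((1 - rho) / rho)
             * ((1 / rho - 1) * ln n%:R ^+ 2) `^ (1 / rho - 2))).
Proof.
split.
  have s0 : 0 < Num.sqrt (2 * pi) :> R by rewrite sqrtr_gt0 mulr_gt0 ?pi_gt0.
  exists (expR (- (3 / 2)) / (4 * Num.sqrt (2 * pi))); split.
    by rewrite divr_gt0 ?expR_gt0 ?mulr_gt0.
  move=> rho rho01 rho2 n n2 d T P X hX; have [rho0 rho1] := andP rho01.
  have b1 : 1 / rho - 1 < 1 by rewrite ltrBlDr ltr_pdivrMr//; lra.
  have lower := orthant_ratio_ge_log rho01 n2 hX.
  by have upper := orthant_ratio_le_Beta rho01 n2 hX b1; split.
move=> rho rho01 rho2; have [rho0 rho1] := andP rho01.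
have b1 : 1 < 1 / rho - 1 by rewrite ltrBrDr ltr_pdivlMr//; lra.
split; last exact: orthant_ratio_le_log.
move=> n n2 hn d T P X hX.
by have := orthant_ratio_ge_Gamma rho01 n2 hX b1 hn.
Qed.
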